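(* Let $\rho>0$, let $f$ be analytic inside and on the parabola $P_\rho$, and suppose that, for some $\beta<1/2$ and some constant $\mathcal{K}>0$, $|f(z)|\le\mathcal{K}|z|^{\beta}$ as $|z|\to\infty$ in $D_\rho$. Let $0\le x_0<x_1<\cdots<x_n<\infty$ be a set of distinct points on $\mathbb{R}_+$ and let $p_n$ be the unique polynomial of degree (at most) $n$ which interpolates $f$ at these points. Then, for every $x\in\mathbb{R}_+$, $$f(x)-p_n(x)=\frac{1}{2\pi\mathrm{i}}\int_{P_\rho}\frac{\phi(x)f(z)}{\phi(z)(z-x)}\,\mathrm{d}z,$$ where $\phi(z)=c\prod_{j=0}^{n}(z-x_j)$ and $c$ is an arbitrary nonzero constant.
   Context: $\mathbb{R}_+=[0,\infty)$. For $z\in\mathbb{C}\setminus\mathbb{R}_+$, $\sqrt{-z}$ denotes the branch with cut along the positive real axis that is real and positive for $z<0$. $P_\rho=\{z\in\mathbb{C}:\Re(\sqrt{-z})=\rho\}$ is a parabola opening to the right with vertex $-\rho^2$ and focus $0$, and $D_\rho=\{z\in\mathbb{C}:\Re(\sqrt{-z})<\rho\}$ is its interior (which contains $\mathbb{R}_+$). ''Analytic inside and on $P_\rho$'' means analytic in a neighbourhood of $D_\rho\cup P_\rho$. Contour integrals over $P_\rho$ are taken in the counterclockwise direction, i.e. with $D_\rho$ on the left (from $\infty$ in the upper half plane, through $-\rho^2$, to $\infty$ in the lower half plane). *)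

(* Defs.v *)
From Stdlib Require Import Reals Lra Psatz.
From Coquelicot Require Import Coquelicot.
Open Scope R_scope.

(* Principal square root, with cut along the negative real axis; on the cut
   itself the value with nonnegative imaginary part is taken. *)
Definition Csqrt (w : C) : C :=
  (sqrt ((Cmod w + Re w) / 2),
   if Rlt_dec (Im w) 0 then - sqrt ((Cmod w - Re w) / 2)
   else sqrt ((Cmod w - Re w) / 2)).

(* [sqrt_neg z] is sqrt(-z): cut along the positive real axis, positive for
   z < 0.  On the cut both boundary values are purely imaginary, so the
   real part, hence [parabola] and [parabola_interior] below, does not depend
   on the convention made there. *)
Definition sqrt_neg (z : C) : C := Csqrt (- z)%C.

Definition parabola (rho : R) (z : C) : Prop := Re (sqrt_neg z) = rho.

Definition parabola_interior (rho : R) (z : C) : Prop := Re (sqrt_neg z) < rho.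

Definition analytic_near (f : C -> C) (A : C -> Prop) : Prop :=
  exists U : C -> Prop,
    open U /\ (forall z, A z -> U z) /\
    forall z, U z -> @ex_derive C_AbsRing C_NormedModule f z.

(* The solution of sqrt(-z) = rho + i t.  As t increases, z comes from infinity
   in the upper half plane, passes through - rho^2 at t = 0, and goes to
   infinity in the lower half plane. *)
Definition parabola_path (rho t : R) : C :=
  (- (((rho, t) : C) * ((rho, t) : C)))%C.

(* The contour integral of [g] along the differentiable path [gamma],
   parametrized by the whole real line, converges to [l]. *)
Definition is_contour_int (gamma : R -> C) (g : C -> C) (l : C) : Prop :=
  exists dgamma : R -> C,
    (forall t : R, @is_derive R_AbsRing C_R_NormedModule gamma t (dgamma t)) /\
    @is_RInt_gen C_R_NormedModule (fun t => g (gamma t) * dgamma t)%C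
      (Rbar_locally m_infty) (Rbar_locally p_infty) l.

Definition poly_deg_le (n : nat) (p : C -> C) : Prop :=
  exists a : nat -> C,
    forall z, p z = @sum_n C_AbelianMonoid (fun k => a k * z ^ k)%C n.

Definition interpolant (n : nat) (x : nat -> R) (f p : C -> C) : Prop :=
  poly_deg_le n p /\
  forall j, (j <= n)%nat -> p (RtoC (x j)) = f (RtoC (x j)).

(* u 0 * ... * u n, with n + 1 factors *)
Fixpoint Cprod_n (u : nat -> C) (n : nat) : C :=
  match n with
  | O => u O
  | S m => (Cprod_n u m * u (S m))%C
  end.

Definition node_poly (c : C) (n : nat) (x : nat -> R) (z : C) : C :=
  (c * Cprod_n (fun j => z - RtoC (x j)) n)%C.

Lemma Cmod_sqr (w : C) : Cmod w * Cmod w = Re w * Re w + Im w * Im w.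
Proof.
unfold Cmod, Re, Im; rewrite sqrt_sqrt; [ring | nra].
Qed.

Lemma Csqrt_sqr (w : C) : (Csqrt w * Csqrt w = w)%C.
Proof.
pose proof (Cmod_sqr w) as H; pose proof (Cmod_ge_0 w) as H0.
destruct w as [a b]; unfold Csqrt; set (m := Cmod (a, b)) in *.
simpl Re in *; simpl Im in *.
assert (Hp : 0 <= (m + a) / 2) by nra.
assert (Hm : 0 <= (m - a) / 2) by nra.
pose proof (sqrt_sqrt _ Hp) as Sp; pose proof (sqrt_sqrt _ Hm) as Sm.
assert (Hpm : sqrt ((m + a) / 2) * sqrt ((m - a) / 2) = Rabs b / 2).
{ rewrite <- sqrt_mult by assumption.
  replace ((m + a) / 2 * ((m - a) / 2)) with ((b / 2) * (b / 2)) by nra.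
  change (b / 2 * (b / 2)) with (Rsqr (b / 2)); rewrite sqrt_Rsqr_abs.
  unfold Rdiv; rewrite Rabs_mult, (Rabs_pos_eq (/ 2)); lra. }
unfold Cmult; simpl.
destruct (Rlt_dec b 0) as [Hb | Hb].
- rewrite (Rabs_left _ Hb) in Hpm; f_equal; nra.
- rewrite (Rabs_pos_eq b) in Hpm by lra; f_equal; nra.
Qed.

Lemma Re_Csqrt_ge0 (w : C) : 0 <= Re (Csqrt w).
Proof. apply sqrt_pos. Qed.

Lemma sqrt_neg_path (rho t : R) :
  0 < rho -> sqrt_neg (parabola_path rho t) = (rho, t).
Proof.
intros Hr; unfold sqrt_neg, parabola_path.
replace (- - ((rho, t) * (rho, t)))%C with ((rho, t) * (rho, t))%C by ring.
pose proof (Csqrt_sqr ((rho, t) * (rho, t))%C) as H.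
pose proof (Re_Csqrt_ge0 ((rho, t) * (rho, t))%C) as H0.
destruct (Csqrt _) as [u v]; unfold Cmult in H; simpl in *.
injection H as H1 H2.
assert (H3 : u * v = rho * t) by lra.
assert (H4 : (u - rho) * ((u + rho) * (u * u + t * t)) = 0).
{ replace ((u - rho) * ((u + rho) * (u * u + t * t)))
    with (u * u * (u * u - (rho * rho - t * t)) - (rho * t) * (rho * t)) by ring.
  rewrite <- H1, <- H3; ring. }
destruct (Rmult_integral _ _ H4) as [H5 | H5].
- assert (u = rho) by lra; subst u; f_equal; nra.
- destruct (Rmult_integral _ _ H5) as [H6 | H6]; [lra |].
  assert (u = 0) by nra; assert (t = 0) by nra; subst; nra.
Qed.

Lemma parabola_path_image (rho : R) (z : C) :
  0 < rho -> (parabola rho z <-> exists t, z = parabola_path rho t).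
Proof.
intros Hr; split.
- intros H; exists (Im (sqrt_neg z)).
  unfold parabola_path.
  replace ((rho, Im (sqrt_neg z)) : C) with (sqrt_neg z)
    by (unfold parabola in H; destruct (sqrt_neg z); simpl in *; now subst).
  unfold sqrt_neg; rewrite Csqrt_sqr; ring.
- intros [t ->]; unfold parabola; now rewrite sqrt_neg_path.
Qed.

(* Main.v *)
Require Import Defs.
From Stdlib Require Import Reals Lra Lia Psatz.
From Coquelicot Require Import Coquelicot.
Open Scope R_scope.

(** The substitution z = - w^2 with w = sqrt(-z) turns the closed parabolic
    region into the strip 0 <= Re w <= rho, the parabola into the line
    Re w = rho, and the branch cut into the imaginary axis.  A function g of z
    becomes the 1-form g(- w^2) (- 2 w) dw, whose density h is odd, so the
    integral of h over a symmetric segment of the imaginary axis is zero.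
    If h is holomorphic for 0 < Re w <= rho and continuous up to Re w = 0,
    Goursat's theorem on the rectangles with abscissae s and rho, followed by
    s -> 0, shows that the integral of h over the segment from rho - i T to
    rho + i T differs from 0 only by the horizontal sides, which disappear as
    T -> oo when h tends to 0 ([strip_int_cv0]).  Goursat's theorem is proved
    by bisection, because complex differentiability is assumed without
    continuity of the derivative.

    For a >= 0 this is applied to the difference quotient
    (f(z) - f(a)) / (z - a), whose singularity at a, a point of the imaginary
    w-axis, is removed by the value f'(a).  There h is O(|z|^(beta - 1/2))
    plus O(|z|^(-1/2)): this is where beta < 1/2 enters.  The remaining term
    f(a) / (z - a) is integrated explicitly with logarithms and arctangents.
    Cauchy's formula follows ([pv_Cauchy]), with the integral over the
    parabola taken as a limit over symmetric segments -T <= t <= T, the only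
    sense in which it need converge.

    The identity 1/((z-s)(z-y)) = (1/(z-y) - 1/(z-s)) / (y-s) is the recursion
    of divided differences, and (f - p_n) / phi_n satisfies the same recursion
    when p_n is in Newton's form.  Induction on the number of nodes gives the
    contour formula for (f - p_n) / phi_n as a symmetric limit
    ([pv_Hermite]).  Finally the integrand of that formula is O(1/t^2), so the
    symmetric limit is an improper integral over the whole parabola
    ([contour_int_of_pv]). *)

(** * Complex continuity and line integrals *)

(** The metric structure of C as a valued field is used here, because products
    and compositions of continuous maps are available for it; line integrals
    use the product structure of R * R, and [Ccont_path] connects the two. *)
Definition Ccont (h : C -> C) (z : C) : Prop :=
  @continuous (AbsRing_UniformSpace C_AbsRing) (AbsRing_UniformSpace C_AbsRing) h z.

Definition Cdiff (h : C -> C) (z : C) : Prop :=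
  @ex_derive C_AbsRing C_NormedModule h z.

Lemma Ccont_eps (h : C -> C) (z : C) :
  Ccont h z <-> forall eps, 0 < eps -> exists delta, 0 < delta /\
    forall w, Cmod (w - z) < delta -> Cmod (h w - h z) < eps.
Proof.
split.
- intros H eps He.
  destruct (proj1 (filterlim_locally _ _) H (mkposreal eps He)) as [d Hd].
  exists d; split; [apply cond_pos | exact Hd].
- intros H; apply filterlim_locally; intros [eps He].
  destruct (H eps He) as [d [Hd0 Hd]].
  exists (mkposreal d Hd0); exact Hd.
Qed.

Lemma is_derive_C_eps (h : C -> C) (z l : C) :
  @is_derive C_AbsRing C_NormedModule h z l ->
  forall eps, 0 < eps -> exists delta, 0 < delta /\
    forall w, Cmod (w - z) < delta ->
      Cmod (h w - h z - (w - z) * l) <= eps * Cmod (w - z).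
Proof.
intros [_ H] eps He.
destruct (H z (fun P HP => HP) (mkposreal eps He)) as [d Hd].
exists d; split; [apply cond_pos | exact Hd].
Qed.

(** The two module structures of C over itself, one on the product topology and
    one on the topology of the absolute value, have the same derivatives. *)
Lemma is_derive_C_AbsRing (h : C -> C) (z l : C) :
  @is_derive C_AbsRing C_NormedModule h z l <->
  @is_derive C_AbsRing (AbsRing_NormedModule C_AbsRing) h z l.
Proof.
split; intros [[H1 H2 H3] H]; split; try exact H; constructor; assumption.
Qed.

Lemma Cdiff_Ccont (h : C -> C) (z : C) : Cdiff h z -> Ccont h z.
Proof.
intros [l Hl].
apply (@ex_derive_continuous C_AbsRing (AbsRing_NormedModule C_AbsRing)).
exists l; apply is_derive_C_AbsRing, Hl.
Qed.

Lemma Cmod_pair_le (a b : R) : Cmod (a, b) <= Rabs a + Rabs b.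
Proof.
replace ((a, b) : C) with (RtoC a + Ci * RtoC b)%C
  by (unfold RtoC, Ci, Cmult, Cplus; simpl; f_equal; ring).
eapply Rle_trans; [apply Cmod_triangle|].
rewrite Cmod_mult, Cmod_Ci, !Cmod_R; lra.
Qed.

Lemma Ccont_path (h : C -> C) (g : R -> C) (t : R) :
  Ccont h (g t) ->
  (exists k, forall s, Cmod (g s - g t) <= k * Rabs (s - t)) ->
  @continuous R_UniformSpace C_R_NormedModule (fun s => h (g s)) t.
Proof.
intros H [k Hk]; apply filterlim_locally; intros [eps He].
destruct (proj1 (Ccont_eps _ _) H eps He) as [d [Hd0 Hd]].
pose proof (Rabs_pos k) as Hk0.
assert (Hp : 0 < d / (Rabs k + 1)) by (apply Rdiv_lt_0_compat; lra).
exists (mkposreal _ Hp); intros s Hs.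
apply C_NormedModule_mixin_compat1, Hd.
change (Rabs (s - t) < d / (Rabs k + 1)) in Hs.
eapply Rle_lt_trans; [apply Hk|].
apply Rmult_lt_compat_r with (r := Rabs k + 1) in Hs; [|lra].
unfold Rdiv in Hs; rewrite Rmult_assoc, Rinv_l in Hs by lra.
pose proof (Rle_abs k); pose proof (Rabs_pos (s - t)); nra.
Qed.

Lemma Ccont_hor (h : C -> C) (x y : R) :
  Ccont h (x, y) ->
  @continuous R_UniformSpace C_R_NormedModule (fun s => h (s, y)) x.
Proof.
intros H; apply (Ccont_path h (fun s => (s, y))); [exact H|].
exists 1; intros s; unfold Cminus, Cplus, Copp; simpl.
rewrite Rplus_opp_r; eapply Rle_trans; [apply Cmod_pair_le|].
rewrite Rabs_R0; unfold Rminus; lra.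
Qed.

Lemma Ccont_ver (h : C -> C) (x y : R) :
  Ccont h (x, y) ->
  @continuous R_UniformSpace C_R_NormedModule (fun s => h (x, s)) y.
Proof.
intros H; apply (Ccont_path h (fun s => (x, s))); [exact H|].
exists 1; intros s; unfold Cminus, Cplus, Copp; simpl.
rewrite Rplus_opp_r; eapply Rle_trans; [apply Cmod_pair_le|].
rewrite Rabs_R0; unfold Rminus; lra.
Qed.

Notation ex_CInt := (@ex_RInt C_R_NormedModule).
Notation is_CInt := (@is_RInt C_R_NormedModule).
Notation CInt := (@RInt C_R_CompleteNormedModule).

Definition on_rect (P : C -> Prop) (a b c d : R) : Prop :=
  forall x y, a <= x <= b -> c <= y <= d -> P (x, y).

Lemma CInt_correct (g : R -> C) (a b : R) : ex_CInt g a b -> is_CInt g a b (CInt g a b).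
Proof. exact (@RInt_correct C_R_CompleteNormedModule g a b). Qed.

Lemma ex_CInt_hor (h : C -> C) (a b y : R) : a <= b ->
  (forall x, a <= x <= b -> Ccont h (x, y)) -> ex_CInt (fun x => h (x, y)) a b.
Proof.
intros Hab H; apply (@ex_RInt_continuous C_R_CompleteNormedModule).
rewrite Rmin_left, Rmax_right by exact Hab.
intros x Hx; apply Ccont_hor, H, Hx.
Qed.

Lemma ex_CInt_ver (h : C -> C) (c d x : R) : c <= d ->
  (forall y, c <= y <= d -> Ccont h (x, y)) -> ex_CInt (fun y => h (x, y)) c d.
Proof.
intros Hab H; apply (@ex_RInt_continuous C_R_CompleteNormedModule).
rewrite Rmin_left, Rmax_right by exact Hab.
intros y Hx; apply Ccont_ver, H, Hx.
Qed.

Lemma is_CInt_Cmult (k : C) (g : R -> C) (a b : R) (l : C) :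
  is_CInt g a b l -> is_CInt (fun t => k * g t)%C a b (k * l)%C.
Proof.
intros H.
pose proof (@is_RInt_fct_extend_fst R_NormedModule R_NormedModule g a b l H) as H1.
pose proof (@is_RInt_fct_extend_snd R_NormedModule R_NormedModule g a b l H) as H2.
apply (@is_RInt_fct_extend_pair R_NormedModule R_NormedModule); simpl.
- apply (is_RInt_minus (V := R_NormedModule) (fun t => fst k * fst (g t)) (fun t => snd k * snd (g t)));
    apply (is_RInt_scal (V := R_NormedModule)); assumption.
- apply (is_RInt_plus (V := R_NormedModule) (fun t => fst k * snd (g t)) (fun t => snd k * fst (g t)));
    apply (is_RInt_scal (V := R_NormedModule)); assumption.
Qed.

Lemma is_CInt_ext (f g : R -> C) (a b : R) (l : C) :
  (forall t, f t = g t) -> is_CInt f a b l -> is_CInt g a b l.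
Proof. intros H; apply (@is_RInt_ext C_R_NormedModule); intros t _; apply H. Qed.

Lemma is_CInt_plus (f g : R -> C) (a b : R) (lf lg : C) :
  is_CInt f a b lf -> is_CInt g a b lg -> is_CInt (fun t => f t + g t)%C a b (lf + lg)%C.
Proof. exact (@is_RInt_plus C_R_NormedModule f g a b lf lg). Qed.

Lemma is_CInt_minus (f g : R -> C) (a b : R) (lf lg : C) :
  is_CInt f a b lf -> is_CInt g a b lg -> is_CInt (fun t => f t - g t)%C a b (lf - lg)%C.
Proof. exact (@is_RInt_minus C_R_NormedModule f g a b lf lg). Qed.

Lemma is_CInt_bound (g : R -> C) (a b : R) (l : C) (M : R) :
  a <= b -> (forall t, a <= t <= b -> Cmod (g t) <= M) -> is_CInt g a b l ->
  Cmod l <= (b - a) * M.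
Proof.
intros Hab HM Hl; rewrite Cmod_norm.
apply (@norm_RInt_le_const C_R_NormedModule g a b l M Hab); [|exact Hl].
intros t Ht; specialize (HM t Ht); rewrite Cmod_norm in HM; exact HM.
Qed.

Lemma is_CInt_Chasles (g : R -> C) (a b c : R) (l m : C) :
  is_CInt g a b l -> is_CInt g b c m -> is_CInt g a c (l + m)%C.
Proof. exact (@is_RInt_Chasles C_R_NormedModule g a b c l m). Qed.

Lemma is_CInt_unique (g : R -> C) (a b : R) (l m : C) :
  is_CInt g a b l -> is_CInt g a b m -> l = m.
Proof.
intros Hl Hm.
rewrite <- (@is_RInt_unique C_R_CompleteNormedModule g a b l Hl).
exact (@is_RInt_unique C_R_CompleteNormedModule g a b m Hm).
Qed.

(** * Goursat's theorem on rectangles *)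

(** The integral of h dz along the boundary of [a, b] x [c, d], counterclockwise. *)
Definition rect_int (h : C -> C) (a b c d : R) : C :=
  (CInt (fun x => h (x, c)) a b - CInt (fun x => h (x, d)) a b
   + Ci * (CInt (fun y => h (b, y)) c d - CInt (fun y => h (a, y)) c d))%C.

Lemma CInt_split (g : R -> C) (a m b : R) :
  ex_CInt g a m -> ex_CInt g m b -> CInt g a b = (CInt g a m + CInt g m b)%C.
Proof.
intros H1 H2; symmetry; exact (@RInt_Chasles C_R_CompleteNormedModule g a m b H1 H2).
Qed.

Lemma rect_int_split (h : C -> C) (a m b c k d : R) :
  a <= m <= b -> c <= k <= d -> on_rect (Ccont h) a b c d ->
  rect_int h a b c d =
  ((rect_int h a m c k + rect_int h a m k d)
   + (rect_int h m b c k + rect_int h m b k d))%C.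
Proof.
intros Hm Hk H; unfold rect_int.
assert (Eh : forall y, c <= y <= d ->
  CInt (fun x => h (x, y)) a b
  = (CInt (fun x => h (x, y)) a m + CInt (fun x => h (x, y)) m b)%C).
{ intros y Hy; apply CInt_split; apply (ex_CInt_hor h); try lra;
    intros; apply H; lra. }
assert (Ev : forall x, a <= x <= b ->
  CInt (fun y => h (x, y)) c d
  = (CInt (fun y => h (x, y)) c k + CInt (fun y => h (x, y)) k d)%C).
{ intros x Hx; apply CInt_split; apply (ex_CInt_ver h); try lra;
    intros; apply H; lra. }
rewrite (Eh c), (Eh d), (Ev a), (Ev b) by lra.
ring.
Qed.

Lemma is_CInt_affine (A B : C) (a b : R) :
  is_CInt (fun t => A + B * RtoC t)%C a b
    ((A * RtoC b + B * RtoC (b * b / 2)) - (A * RtoC a + B * RtoC (a * a / 2)))%C.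
Proof.
assert (HR : forall p q : R, is_RInt (fun t => p + q * t) a b
   ((p * b + q * (b * b / 2)) - (p * a + q * (a * a / 2)))).
{ intros p q.
  apply (is_RInt_derive (V := R_CompleteNormedModule) (fun t => p * t + q * (t * t / 2))).
  - intros; auto_derive; [exact I | field].
  - intros; apply (ex_derive_continuous (V := R_NormedModule)); auto_derive; exact I. }
destruct A as [A1 A2], B as [B1 B2].
apply (@is_RInt_fct_extend_pair R_NormedModule R_NormedModule); simpl.
- eapply is_RInt_ext; [|replace (_ + _) with ((A1 * b + B1 * (b * b / 2)) - (A1 * a + B1 * (a * a / 2))) by ring; apply HR].
  intros; simpl; ring.
- eapply is_RInt_ext; [|replace (_ + _) with ((A2 * b + B2 * (b * b / 2)) - (A2 * a + B2 * (a * a / 2))) by ring; apply HR].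
  intros; simpl; ring.
Qed.

(** An affine function has a primitive, so its boundary integral is zero and
    only the deviation from it contributes. *)
Lemma rect_int_near_affine (h : C -> C) (A B : C) (a b c d M : R) :
  a <= b -> c <= d -> on_rect (Ccont h) a b c d ->
  on_rect (fun z => Cmod (h z - (A + B * z)) <= M)%C a b c d ->
  Cmod (rect_int h a b c d) <= 2 * ((b - a) + (d - c)) * M.
Proof.
intros Hab Hcd Hc HM.
assert (Hh : forall y, c <= y <= d -> Cmod (CInt (fun x => h (x, y)) a b -
  ((((A + B * (Ci * RtoC y)) * RtoC b + B * RtoC (b * b / 2)) - ((A + B * (Ci * RtoC y)) * RtoC a + B * RtoC (a * a / 2))))) <= (b - a) * M).
{ intros y Hy.
  eapply is_CInt_bound; [exact Hab | | apply is_CInt_minus; [|apply is_CInt_affine]].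
  2: apply CInt_correct, (ex_CInt_hor h); [lra | intros; apply Hc; lra].
  intros x Hx; simpl.
  replace ((A + B * (Ci * RtoC y)) + B * RtoC x)%C with (A + B * (x, y))%C
    by (unfold Cplus, Cmult, Ci, RtoC; simpl; f_equal; ring).
  apply HM; assumption. }
assert (Hv : forall x, a <= x <= b -> Cmod (CInt (fun y => h (x, y)) c d -
  ((((A + B * RtoC x) * RtoC d + (B * Ci) * RtoC (d * d / 2)) - ((A + B * RtoC x) * RtoC c + (B * Ci) * RtoC (c * c / 2))))) <= (d - c) * M).
{ intros x Hx.
  eapply is_CInt_bound; [exact Hcd | | apply is_CInt_minus; [|apply is_CInt_affine]].
  2: apply CInt_correct, (ex_CInt_ver h); [lra | intros; apply Hc; lra].
  intros y Hy; simpl.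
  replace ((A + B * RtoC x) + B * Ci * RtoC y)%C with (A + B * (x, y))%C
    by (unfold Cplus, Cmult, Ci, RtoC; simpl; f_equal; ring).
  apply HM; assumption. }
pose proof (Hh c (conj (Rle_refl c) Hcd)) as H1.
pose proof (Hh d (conj Hcd (Rle_refl d))) as H2.
pose proof (Hv b (conj Hab (Rle_refl b))) as H3.
pose proof (Hv a (conj (Rle_refl a) Hab)) as H4.
match type of H1 with Cmod ?u <= _ => set (u1 := u) in * end.
match type of H2 with Cmod ?u <= _ => set (u2 := u) in * end.
match type of H3 with Cmod ?u <= _ => set (u3 := u) in * end.
match type of H4 with Cmod ?u <= _ => set (u4 := u) in * end.
assert (E : rect_int h a b c d = (u1 - u2 + Ci * (u3 - u4))%C).
{ unfold rect_int, u1, u2, u3, u4.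
  generalize (CInt (fun x => h (x, c)) a b) (CInt (fun x => h (x, d)) a b)
    (CInt (fun y => h (b, y)) c d) (CInt (fun y => h (a, y)) c d).
  intros [] [] [] [].
  destruct A, B.
  unfold Cplus, Cmult, Ci, RtoC, Cminus, Copp, Cplus; simpl; f_equal; field. }
rewrite E.
eapply Rle_trans; [apply Cmod_triangle|].
rewrite Cmod_mult, Cmod_Ci.
unfold Cminus at 1 2.
pose proof (Cmod_triangle u1 (- u2)) as T1.
pose proof (Cmod_triangle u3 (- u4)) as T2.
rewrite Cmod_opp in T1, T2; lra.
Qed.

(** The lower ends increase to a limit, to which the upper ends decrease since
    the lengths tend to 0. *)
Lemma nested_intervals (u v : nat -> R) (L : R) :
  0 <= L -> (forall n, u n <= u (S n)) -> (forall n, v (S n) <= v n) ->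
  (forall n, v n - u n = L / 2 ^ n) ->
  exists x, forall n, u n <= x <= v n.
Proof.
intros HL Hu Hv Huv.
assert (Hp : forall n, 0 <= L / 2 ^ n).
{ intros n; apply Rmult_le_pos; [exact HL|].
  apply Rlt_le, Rinv_0_lt_compat, pow_lt; lra. }
assert (Hv0 : forall n, v n <= v O) by (induction n; [lra | specialize (Hv n); lra]).
destruct (ex_finite_lim_seq_incr u (v O) Hu) as [x Hx].
{ intros n; specialize (Huv n); specialize (Hp n); specialize (Hv0 n); lra. }
exists x; intros n; split.
- exact (is_lim_seq_incr_compare u x Hx Hu n).
- apply (is_lim_seq_decr_compare v x); [|exact Hv].
  apply is_lim_seq_ext with (fun n => u n + L * (/ 2) ^ n).
  { intros k; specialize (Huv k); rewrite pow_inv; unfold Rdiv in Huv; lra. }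
  replace (Finite x) with (Finite (x + L * 0)) by (f_equal; ring).
  apply is_lim_seq_plus'; [exact Hx|].
  apply (is_lim_seq_scal_l _ L 0), is_lim_seq_geom.
  rewrite Rabs_pos_eq; lra.
Qed.

Definition quarter_of (q r : R * R * R * R) : Prop :=
  let '(a, b, c, d) := r in
  let m := (a + b) / 2 in
  let k := (c + d) / 2 in
  q = (a, m, c, k) \/ q = (a, m, k, d) \/ q = (m, b, c, k) \/ q = (m, b, k, d).

(** A Cousin-type induction principle on rectangles: if P passes from the four
    quarters to the whole and holds for all small rectangles around each point,
    it holds for the whole.  Otherwise, choosing a failing quarter forever
    produces nested rectangles that shrink to a point, where P fails at
    arbitrarily small scales.  The small rectangles must contain the point,
    because the linear approximation in [goursat] is only good at the scale of
    the distance to the point of tangency. *)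
Lemma rect_bisection (P : R * R * R * R -> Prop)
  (P_dec : forall r, {P r} + {~ P r}) (a b c d : R) :
  a <= b -> c <= d ->
  (forall a' b' c' d', a <= a' <= b' -> b' <= b -> c <= c' <= d' -> d' <= d ->
    (forall q, quarter_of q (a', b', c', d') -> P q) -> P (a', b', c', d')) ->
  (forall x y, a <= x <= b -> c <= y <= d -> exists delta, 0 < delta /\
     forall a' b' c' d', a <= a' <= x -> x <= b' <= b -> c <= c' <= y -> y <= d' <= d ->
       b' - a' < delta -> d' - c' < delta -> P (a', b', c', d')) ->
  P (a, b, c, d).
Proof.
intros Hab Hcd Hsplit Hloc.
destruct (P_dec (a, b, c, d)) as [H | H0]; [exact H | exfalso].
(* If three quarters satisfy P the fourth one does not, so its failure need not
   be tested. *)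
set (next := fun r : R * R * R * R => let '(a, b, c, d) := r in
  let m := (a + b) / 2 in let k := (c + d) / 2 in
  if P_dec (a, m, c, k) then
    if P_dec (a, m, k, d) then
      if P_dec (m, b, c, k) then (m, b, k, d) else (m, b, c, k)
    else (a, m, k, d)
  else (a, m, c, k)).
set (s := fix s n := match n with O => (a, b, c, d) | S n => next (s n) end).
set (u := fun n => fst (fst (fst (s n)))).
set (v := fun n => snd (fst (fst (s n)))).
set (p := fun n => snd (fst (s n))).
set (q := fun n => snd (s n)).
assert (Hs : forall n, s n = (u n, v n, p n, q n)).
{ intros n; unfold u, v, p, q; destruct (s n) as [[[? ?] ?] ?]; reflexivity. }
assert (Hq : forall n, quarter_of (s (S n)) (s n)).
{ intros n; change (s (S n)) with (next (s n)); rewrite Hs; simpl.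
  destruct (P_dec _); [|tauto].
  destruct (P_dec _); [|tauto].
  destruct (P_dec _); tauto. }
assert (Hstep : forall n,
  (u (S n) = u n /\ v (S n) = (u n + v n) / 2 \/ u (S n) = (u n + v n) / 2 /\ v (S n) = v n)
  /\ (p (S n) = p n /\ q (S n) = (p n + q n) / 2 \/ p (S n) = (p n + q n) / 2 /\ q (S n) = q n)).
{ intros n; specialize (Hq n); rewrite !Hs in Hq; simpl in Hq.
  destruct Hq as [E | [E | [E | E]]]; injection E as E1 E2 E3 E4;
    rewrite E1, E2, E3, E4; tauto. }
assert (Hw : forall n, v n - u n = (b - a) / 2 ^ n /\ q n - p n = (d - c) / 2 ^ n).
{ induction n as [|n IH]; [unfold u, v, p, q; simpl; lra|].
  assert (0 < 2 ^ n) by (apply pow_lt; lra).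
  replace ((b - a) / 2 ^ S n) with ((b - a) / 2 ^ n / 2) by (simpl; field; lra).
  replace ((d - c) / 2 ^ S n) with ((d - c) / 2 ^ n / 2) by (simpl; field; lra).
  destruct (Hstep n) as [H1 H2]; lra. }
assert (Hp : forall n L, 0 <= L -> 0 <= L / 2 ^ n).
{ intros n L HL; apply Rmult_le_pos; [exact HL|].
  apply Rlt_le, Rinv_0_lt_compat, pow_lt; lra. }
assert (Hle : forall n, u n <= v n /\ p n <= q n).
{ intros n; destruct (Hw n).
  pose proof (Hp n (b - a)); pose proof (Hp n (d - c)); lra. }
assert (Hmono : forall n, u n <= u (S n) /\ v (S n) <= v n /\ p n <= p (S n) /\ q (S n) <= q n).
{ intros n; destruct (Hle n); destruct (Hstep n); lra. }
assert (Hin : forall n, a <= u n /\ v n <= b /\ c <= p n /\ q n <= d).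
{ induction n as [|n IH]; [unfold u, v, p, q; simpl; lra|].
  specialize (Hmono n); lra. }
assert (Hbad : forall n, ~ P (s n)).
{ induction n as [|n IH]; [exact H0|].
  intros HP; apply IH; rewrite Hs.
  specialize (Hin n); specialize (Hle n).
  apply Hsplit; try lra.
  rewrite <- Hs; change (s (S n)) with (next (s n)) in HP.
  rewrite Hs in *; simpl in HP; simpl.
  destruct (P_dec _); [|contradiction].
  destruct (P_dec _); [|contradiction].
  destruct (P_dec _); [|contradiction].
  intros r [-> | [-> | [-> | ->]]]; assumption. }
destruct (nested_intervals u v (b - a)) as [x Hx]; try (intros; apply Hmono); try (intros; apply Hw); [lra|].
destruct (nested_intervals p q (d - c)) as [y Hy]; try (intros; apply Hmono); try (intros; apply Hw); [lra|].
destruct (Hloc x y (Hx O) (Hy O)) as [delta [Hd Hsmall]].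
destruct (pow_lt_1_zero (/ 2)) with (y := delta / (1 + (b - a) + (d - c))) as [N HN].
{ rewrite Rabs_pos_eq; lra. }
{ apply Rdiv_lt_0_compat; lra. }
specialize (HN N (le_n N)).
rewrite pow_inv, Rabs_pos_eq in HN by (apply Rlt_le, Rinv_0_lt_compat, pow_lt; lra).
apply (Hbad N); rewrite Hs.
destruct (Hw N) as [W1 W2].
specialize (Hin N); specialize (Hx N); specialize (Hy N).
assert (0 < / 2 ^ N) by (apply Rinv_0_lt_compat, pow_lt; lra).
apply Rmult_lt_compat_r with (r := 1 + (b - a) + (d - c)) in HN; [|lra].
unfold Rdiv in *; rewrite Rmult_assoc, Rinv_l in HN by lra.
apply Hsmall; nra.
Qed.

Lemma Cmod_rect_le (a b c d x y x' y' : R) :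
  a <= x <= b -> a <= x' <= b -> c <= y <= d -> c <= y' <= d ->
  Cmod ((x', y') - (x, y)) <= (b - a) + (d - c).
Proof.
intros; unfold Cminus, Cplus, Copp; simpl.
eapply Rle_trans; [apply Cmod_pair_le|].
apply Rplus_le_compat; apply Rabs_le; lra.
Qed.

(** The property propagated by bisection bounds the boundary integral by eps
    times the square of the half-perimeter: the four squares of the quarters
    add up to the square of the whole, and near a point of differentiability
    the error eps |z - z0| of the linear approximation, integrated along the
    perimeter, is of this order. *)
Theorem goursat (h : C -> C) (a b c d : R) :
  a <= b -> c <= d -> on_rect (Cdiff h) a b c d -> rect_int h a b c d = RtoC 0.
Proof.
intros Hab Hcd Hh.
assert (Hc : on_rect (Ccont h) a b c d) by (intros x y Hx Hy; apply Cdiff_Ccont, Hh; assumption).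
apply Cmod_eq_0.
destruct (Cmod_ge_0 (rect_int h a b c d)) as [Hpos | E]; [exfalso | symmetry; exact E].
set (J := Cmod (rect_int h a b c d)) in *.
(* With this eps the bound is at most J / 2, which contradicts J > 0. *)
set (eps := J / (2 * (1 + ((b - a) + (d - c)) ^ 2))).
assert (HS : 0 <= ((b - a) + (d - c)) ^ 2) by apply pow2_ge_0.
assert (Heps : 0 < eps) by (apply Rdiv_lt_0_compat; lra).
set (P := fun r : R * R * R * R => let '(a, b, c, d) := r in
  Cmod (rect_int h a b c d) <= eps * ((b - a) + (d - c)) ^ 2).
assert (HP : P (a, b, c, d)).
{ apply (rect_bisection P); [ | exact Hab | exact Hcd | | ].
  - intros [[[? ?] ?] ?]; apply Rle_dec.
  - intros a' b' c' d' H1 H2 H3 H4 Hq; simpl.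
    rewrite (rect_int_split h a' ((a' + b') / 2) b' c' ((c' + d') / 2) d'); try lra.
    2: intros x y Hx Hy; apply Hc; lra.
    pose proof (Hq _ (or_introl eq_refl)) as Q1.
    pose proof (Hq _ (or_intror (or_introl eq_refl))) as Q2.
    pose proof (Hq _ (or_intror (or_intror (or_introl eq_refl)))) as Q3.
    pose proof (Hq _ (or_intror (or_intror (or_intror eq_refl)))) as Q4.
    simpl in Q1, Q2, Q3, Q4.
    eapply Rle_trans; [apply Cmod_triangle|].
    eapply Rle_trans; [apply Rplus_le_compat; apply Cmod_triangle|].
    lra.
  - intros x y Hx Hy.
    destruct (Hh x y Hx Hy) as [l Hl].
    destruct (is_derive_C_eps h (x, y) l Hl (eps / 2)) as [delta [Hd Hloc]]; [lra|].
    exists (delta / 2); split; [lra|].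
    intros a' b' c' d' Ha' Hb' Hc' Hd' Hw1 Hw2; simpl.
    replace (eps * _) with (2 * ((b' - a') + (d' - c')) * (eps / 2 * ((b' - a') + (d' - c')))) by field.
    apply (rect_int_near_affine h (h (x, y) - (x, y) * l) l); try lra.
    + intros x' y' Hx' Hy'; apply Hc; lra.
    + intros x' y' Hx' Hy'.
      pose proof (Cmod_rect_le a' b' c' d' x y x' y') as Hz.
      replace (h (x', y') - (h (x, y) - (x, y) * l + l * (x', y')))%C
        with (h (x', y') - h (x, y) - ((x', y') - (x, y)) * l)%C by ring.
      eapply Rle_trans; [apply Hloc; lra|].
      apply Rmult_le_compat_l; lra. }
simpl in HP; fold J in HP.
unfold eps in HP.
set (D := (b - a + (d - c)) ^ 2) in *.
replace ((b - a + (d - c)) * ((b - a + (d - c)) * 1)) with D in HP by (unfold D; ring).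
assert (E : J / (2 * (1 + D)) * D = J / 2 * (D / (1 + D))) by (field; lra).
assert (E2 : D / (1 + D) <= 1).
{ apply Rmult_le_reg_r with (1 + D); [lra|]; unfold Rdiv; rewrite Rmult_assoc, Rinv_l; lra. }
nra.
Qed.

(** * Integrals along a vertical strip *)

Lemma im_le_Cmod (z : C) : Rabs (Im z) <= Cmod z.
Proof. eapply Rle_trans; [apply Rmax_r | apply Rmax_Cmod]. Qed.

Lemma Ccont_uniform (h : C -> C) (a b c d : R) :
  on_rect (Ccont h) a b c d ->
  forall eps, 0 < eps -> exists delta, 0 < delta /\
    forall x y x' y', a <= x <= b -> c <= y <= d -> a <= x' <= b -> c <= y' <= d ->
      Rabs (x' - x) < delta -> Rabs (y' - y) < delta ->
      Cmod (h (x', y') - h (x, y)) <= eps.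
Proof.
intros Hc eps Heps.
assert (H2 : forall x y, a <= x <= b -> c <= y <= d ->
  continuity_2d_pt (fun x y => Re (h (x, y))) x y /\
  continuity_2d_pt (fun x y => Im (h (x, y))) x y).
{ intros x y Hx Hy.
  assert (Hl : forall e : posreal, exists delta, 0 < delta /\
    forall u v, Rabs (u - x) < delta -> Rabs (v - y) < delta -> Cmod (h (u, v) - h (x, y)) < e).
  { intros e.
    destruct (proj1 (Ccont_eps _ _) (Hc x y Hx Hy) e (cond_pos e)) as [delta [Hd H]].
    exists (delta / 2); split; [lra|].
    intros u v Hu Hv; apply H.
    unfold Cminus, Cplus, Copp; simpl.
    eapply Rle_lt_trans; [apply Cmod_pair_le|]; unfold Rminus in *; lra. }
  split; intros e; destruct (Hl e) as [delta [Hd H]]; exists (mkposreal delta Hd);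
    intros u v Hu Hv; specialize (H u v Hu Hv).
  - eapply Rle_lt_trans; [|exact H].
    exact (re_le_Cmod (h (u, v) - h (x, y))).
  - eapply Rle_lt_trans; [|exact H].
    exact (im_le_Cmod (h (u, v) - h (x, y))). }
assert (He : 0 < eps / 2) by lra.
destruct (uniform_continuity_2d (fun x y => Re (h (x, y))) a b c d
  (fun x y Hx Hy => proj1 (H2 x y Hx Hy)) (mkposreal _ He)) as [d1 H1].
destruct (uniform_continuity_2d (fun x y => Im (h (x, y))) a b c d
  (fun x y Hx Hy => proj2 (H2 x y Hx Hy)) (mkposreal _ He)) as [d2 H3].
exists (Rmin d1 d2); split; [apply Rmin_pos; apply cond_pos|].
intros x y x' y' Hx Hy Hx' Hy' Hdx Hdy.
pose proof (Rmin_l d1 d2); pose proof (Rmin_r d1 d2).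
specialize (H1 x y x' y' Hx Hy Hx' Hy').
specialize (H3 x y x' y' Hx Hy Hx' Hy').
simpl in H1, H3.
replace (h (x', y') - h (x, y))%C with
  (Re (h (x', y')) - Re (h (x, y)), Im (h (x', y')) - Im (h (x, y)))
  by reflexivity.
eapply Rle_trans; [apply Cmod_pair_le|].
assert (Hu : Rabs (x' - x) < d1) by lra; assert (Hv : Rabs (y' - y) < d1) by lra.
specialize (H1 Hu Hv).
assert (Hu' : Rabs (x' - x) < d2) by lra; assert (Hv' : Rabs (y' - y) < d2) by lra.
specialize (H3 Hu' Hv'); lra.
Qed.

Lemma CInt_odd (g : R -> C) (T : R) :
  (forall t, g (- t)%R = (- g t)%C) -> ex_CInt g (- T) T -> CInt g (- T) T = RtoC 0.
Proof.
intros Hodd Hex; apply CInt_correct in Hex.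
set (l := CInt g (- T) T) in *.
assert (H : is_CInt g (- T) T (- l)%C).
{ pose proof (@is_RInt_swap C_R_NormedModule g T (- T) l Hex) as Hs.
  rewrite <- (Ropp_involutive T) in Hs at 1.
  apply (@is_RInt_comp_opp C_R_NormedModule) in Hs.
  eapply is_CInt_ext; [|exact Hs].
  intros t; cbv beta; rewrite Hodd; change (- - g t = g t)%C; ring. }
pose proof (is_CInt_unique _ _ _ _ _ Hex H) as E.
replace l with ((l - - l) * / 2)%C.
- rewrite <- E; unfold Cminus; ring_simplify.
  apply injective_projections; simpl; ring.
- field; intros H2; apply (f_equal fst) in H2; simpl in H2; lra.
Qed.

(** Goursat's theorem on [s, rho] x [-T, T] compares the integral on the line
    Re w = rho with the one on Re w = s.  The latter tends to the integral on
    the imaginary axis as s -> 0, which is 0 because h is odd.  The left side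
    only has to be approached, so h need not be differentiable on it. *)
Lemma strip_int_cv0 (h : C -> C) (rho : R) :
  0 < rho ->
  (forall w, 0 < Re w <= rho -> Cdiff h w) ->
  (forall w, 0 <= Re w <= rho -> Ccont h w) ->
  (forall w, h (- w) = - h w)%C ->
  (forall eps, 0 < eps -> exists M, forall w, 0 <= Re w <= rho ->
     M <= Rabs (Im w) -> Cmod (h w) <= eps) ->
  forall eps, 0 < eps -> exists T0, forall T, T0 <= T ->
    Cmod (CInt (fun t => h (rho, t)) (- T) T) <= eps.
Proof.
intros Hrho Hdiff Hcont Hodd Hlim eps Heps.
destruct (Hlim (eps / (4 * rho))) as [M HM]; [apply Rdiv_lt_0_compat; lra|].
exists (Rmax M 1); intros T HT.
pose proof (Rmax_l M 1); pose proof (Rmax_r M 1).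
assert (Hc : on_rect (Ccont h) 0 rho (- T) T) by (intros x y Hx Hy; apply Hcont; exact Hx).
destruct (Ccont_uniform h 0 rho (- T) T Hc (eps / (4 * T))) as [delta [Hdelta Hu]].
{ apply Rdiv_lt_0_compat; lra. }
set (s := Rmin (delta / 2) rho).
assert (Hs : 0 < s <= rho) by (split; [apply Rmin_pos; lra | apply Rmin_r]).
assert (Hs2 : s <= delta / 2) by apply Rmin_l.
assert (Hg : rect_int h s rho (- T) T = RtoC 0).
{ apply goursat; try lra.
  intros x y Hx Hy; apply Hdiff; simpl; lra. }
assert (Hex : forall x, 0 <= x <= rho -> ex_CInt (fun y => h (x, y)) (- T) T).
{ intros x Hx; apply (ex_CInt_ver h); [lra | intros; apply Hcont; exact Hx]. }
assert (Haxis : CInt (fun y => h (0, y)) (- T) T = RtoC 0).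
{ apply CInt_odd; [|apply Hex; lra].
  intros t; rewrite <- Hodd; f_equal; unfold Copp; simpl; f_equal; ring. }
assert (Hhor : forall y, Rabs y = T -> Cmod (CInt (fun x => h (x, y)) s rho) <= eps / 4).
{ intros y Hy.
  apply Rle_trans with ((rho - s) * (eps / (4 * rho))).
  - eapply is_CInt_bound; [apply Hs | | apply CInt_correct, (ex_CInt_hor h)].
    + intros x Hx; apply HM; simpl; lra.
    + apply Hs.
    + intros x Hx; apply Hcont; simpl; lra.
  - replace (eps / 4) with (rho * (eps / (4 * rho))) by (field; lra).
    apply Rmult_le_compat_r; [|lra].
    apply Rlt_le, Rdiv_lt_0_compat; lra. }
pose proof (Hhor T (Rabs_pos_eq T ltac:(lra))) as Htop.
pose proof (Hhor (- T) ltac:(rewrite Rabs_Ropp; apply Rabs_pos_eq; lra)) as Hbot.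
assert (Hleft : Cmod (CInt (fun y => h (s, y)) (- T) T) <= eps / 2).
{ replace (CInt (fun y => h (s, y)) (- T) T) with
    (CInt (fun y => h (s, y)) (- T) T - CInt (fun y => h (0, y)) (- T) T)%C
    by (rewrite Haxis; ring).
  replace (eps / 2) with ((T - - T) * (eps / (4 * T))) by (field; lra).
  eapply is_CInt_bound; [lra | | apply is_CInt_minus; apply CInt_correct, Hex; lra].
  intros y Hy; apply Hu; try lra.
  - rewrite Rminus_0_r, Rabs_pos_eq; lra.
  - rewrite Rminus_diag, Rabs_R0; lra. }
unfold rect_int in Hg.
revert Hg Htop Hbot Hleft.
generalize (CInt (fun x => h (x, - T)) s rho) (CInt (fun x => h (x, T)) s rho)
  (CInt (fun y => h (rho, y)) (- T) T) (CInt (fun y => h (s, y)) (- T) T).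
intros B A I L Hg HA HB HL.
assert (E : I = (L + Ci * (B - A))%C).
{ destruct A, B, I, L; unfold Cplus, Cminus, Cmult, Copp, Ci, RtoC in *; simpl in *.
  injection Hg as G1 G2; f_equal; lra. }
rewrite E.
eapply Rle_trans; [apply Cmod_triangle|].
rewrite Cmod_mult, Cmod_Ci.
pose proof (Cmod_triangle B (- A)) as HT2; rewrite Cmod_opp in HT2.
unfold Cminus; lra.
Qed.

(** * Complex differentiation *)

Lemma is_derive_C_of_eps (h : C -> C) (z l : C) :
  (forall eps, 0 < eps -> exists delta, 0 < delta /\
    forall w, Cmod (w - z) < delta ->
      Cmod (h w - h z - (w - z) * l) <= eps * Cmod (w - z)) ->
  @is_derive C_AbsRing C_NormedModule h z l.
Proof.
intros H; split; [apply is_linear_scal_l|].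
intros x Hx eps.
assert (E : z = x) by exact (@is_filter_lim_locally_unique C_AbsRing (AbsRing_NormedModule C_AbsRing) z x Hx).
subst x.
destruct (H eps (cond_pos eps)) as [delta [Hd Hloc]].
exists (mkposreal delta Hd); exact Hloc.
Qed.

Lemma Cdiff_AbsRing (h : C -> C) (z : C) :
  Cdiff h z <-> @ex_derive C_AbsRing (AbsRing_NormedModule C_AbsRing) h z.
Proof. split; intros [l Hl]; exists l; apply is_derive_C_AbsRing, Hl. Qed.

Lemma Cdiff_const (k z : C) : Cdiff (fun _ => k) z.
Proof. exact (@ex_derive_const C_AbsRing C_NormedModule k z). Qed.

Lemma Cdiff_id (z : C) : Cdiff (fun w => w) z.
Proof. apply Cdiff_AbsRing; exact (@ex_derive_id C_AbsRing z). Qed.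

Lemma Cdiff_opp (f : C -> C) (z : C) : Cdiff f z -> Cdiff (fun w => - f w)%C z.
Proof. exact (@ex_derive_opp C_AbsRing C_NormedModule f z). Qed.

Lemma Cdiff_minus (f g : C -> C) (z : C) :
  Cdiff f z -> Cdiff g z -> Cdiff (fun w => f w - g w)%C z.
Proof. exact (@ex_derive_minus C_AbsRing C_NormedModule f g z). Qed.

Lemma Cdiff_mult (f g : C -> C) (z : C) :
  Cdiff f z -> Cdiff g z -> Cdiff (fun w => f w * g w)%C z.
Proof.
intros [df Hf] [dg Hg]; exists (df * g z + f z * dg)%C.
apply is_derive_C_AbsRing in Hf, Hg; apply is_derive_C_AbsRing.
exact (@is_derive_mult C_AbsRing f g z df dg Hf Hg Cmult_comm).
Qed.

Lemma Cdiff_comp (f g : C -> C) (z : C) :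
  Cdiff f (g z) -> Cdiff g z -> Cdiff (fun w => f (g w)) z.
Proof.
intros [df Hf] [dg Hg]; exists (dg * df)%C.
apply is_derive_C_AbsRing in Hg.
exact (@is_derive_comp C_AbsRing C_NormedModule f g z df dg Hf Hg).
Qed.

Lemma Ccont_mult (f g : C -> C) (z : C) :
  Ccont f z -> Ccont g z -> Ccont (fun w => f w * g w)%C z.
Proof. exact (@continuous_mult (AbsRing_UniformSpace C_AbsRing) C_AbsRing f g z). Qed.

Lemma Ccont_comp (f g : C -> C) (z : C) :
  Ccont f (g z) -> Ccont g z -> Ccont (fun w => f (g w)) z.
Proof.
intros Hf Hg.
exact (@continuous_comp (AbsRing_UniformSpace C_AbsRing) (AbsRing_UniformSpace C_AbsRing)
  (AbsRing_UniformSpace C_AbsRing) g f z Hg Hf).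
Qed.

(** The remainder of the linear approximation at z is (w - z)^2 / (z^2 w). *)
Lemma Cdiff_inv (z : C) : z <> RtoC 0 -> Cdiff Cinv z.
Proof.
intros Hz; exists (- / (z * z))%C; apply is_derive_C_of_eps; intros eps Heps.
pose proof (proj1 (Cmod_gt_0 z) Hz) as Hm.
set (m := Cmod z) in *.
assert (Hm3 : 0 < m * m * m) by (repeat apply Rmult_lt_0_compat; lra).
exists (Rmin (m / 2) (eps * (m * m * m) / 2)); split.
{ apply Rmin_pos; [lra|]; assert (0 < eps * (m * m * m)) by (apply Rmult_lt_0_compat; lra); lra. }
intros w Hw.
pose proof (Rmin_l (m / 2) (eps * (m * m * m) / 2)).
pose proof (Rmin_r (m / 2) (eps * (m * m * m) / 2)).
assert (Hwm : m / 2 < Cmod w).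
{ pose proof (Cmod_triangle (z - w) w) as Ht.
  replace (z - w + w)%C with z in Ht by ring; fold m in Ht.
  replace (z - w)%C with (- (w - z))%C in Ht by ring; rewrite Cmod_opp in Ht; lra. }
assert (Hw0 : w <> RtoC 0) by (apply Cmod_gt_0; lra).
replace (/ w - / z - (w - z) * - / (z * z))%C with ((w - z) * ((w - z) * / (z * z * w)))%C
  by (field; split; assumption).
set (d := Cmod (w - z)) in *.
rewrite !Cmod_mult, Cmod_inv by (repeat apply Cmult_neq_0; assumption).
rewrite !Cmod_mult; fold m d.
rewrite (Rmult_comm eps); apply Rmult_le_compat_l; [apply Cmod_ge_0|].
apply Rmult_le_reg_r with (m * m * Cmod w).
{ repeat apply Rmult_lt_0_compat; lra. }
rewrite Rmult_assoc, Rinv_l by (apply Rgt_not_eq; repeat apply Rmult_lt_0_compat; lra).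
assert (eps * (m * m) * (m / 2) <= eps * (m * m) * Cmod w).
{ apply Rmult_le_compat_l; [|lra]; apply Rlt_le; repeat apply Rmult_lt_0_compat; lra. }
lra.
Qed.

Lemma Cdiff_div (f g : C -> C) (z : C) :
  Cdiff f z -> Cdiff g z -> g z <> RtoC 0 -> Cdiff (fun w => f w / g w)%C z.
Proof.
intros Hf Hg H0; apply Cdiff_mult; [exact Hf|].
apply (Cdiff_comp Cinv g); [apply Cdiff_inv, H0 | exact Hg].
Qed.

Lemma Cdiff_ext_away (f g : C -> C) (a z : C) :
  z <> a -> (forall w, w <> a -> f w = g w) -> Cdiff f z -> Cdiff g z.
Proof.
intros Hz Hfg; apply ex_derive_ext_loc.
assert (Hp : 0 < Cmod (z - a)).
{ apply Cmod_gt_0; intros E; apply Hz; replace z with (z - a + a)%C by ring; rewrite E; ring. }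
exists (mkposreal _ Hp); intros w Hw; apply Hfg; intros ->.
change (Cmod (a - z) < Cmod (z - a)) in Hw.
replace (a - z)%C with (- (z - a))%C in Hw by ring; rewrite Cmod_opp in Hw; lra.
Qed.

(** The parameter l is the derivative of f at a, which makes the quotient
    continuous there. *)
Definition diff_quot (f : C -> C) (a l z : C) : C :=
  if Ceq_dec z a then l else ((f z - f a) / (z - a))%C.

Lemma Cminus_neq_0 (z a : C) : z <> a -> (z - a)%C <> RtoC 0.
Proof. intros H E; apply H; replace z with (z - a + a)%C by ring; rewrite E; ring. Qed.

Lemma Cdiff_diff_quot (f : C -> C) (a l z : C) :
  z <> a -> Cdiff f z -> Cdiff (diff_quot f a l) z.
Proof.
intros Hz Hf.
apply (Cdiff_ext_away (fun w => (f w - f a) / (w - a))%C _ a); [exact Hz | |].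
- intros w Hw; unfold diff_quot; destruct (Ceq_dec w a); [contradiction | reflexivity].
- apply Cdiff_div; [| |apply Cminus_neq_0, Hz];
    apply Cdiff_minus; auto using Cdiff_const, Cdiff_id.
Qed.

Lemma Ccont_diff_quot (f : C -> C) (a l z : C) :
  @is_derive C_AbsRing C_NormedModule f a l -> Cdiff f z -> Ccont (diff_quot f a l) z.
Proof.
intros Ha Hf.
destruct (Ceq_dec z a) as [-> | Hz]; [|apply Cdiff_Ccont, Cdiff_diff_quot; assumption].
apply Ccont_eps; intros eps Heps.
destruct (is_derive_C_eps f a l Ha (eps / 2)) as [delta [Hd H]]; [lra|].
exists delta; split; [exact Hd|].
intros w Hw; unfold diff_quot.
destruct (Ceq_dec a a) as [_ | E]; [|contradiction].
destruct (Ceq_dec w a) as [_ | E].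
{ unfold Cminus; rewrite Cplus_opp_r, Cmod_0; exact Heps. }
specialize (H w Hw).
pose proof (Cminus_neq_0 w a E) as E'.
replace ((f w - f a) / (w - a) - l)%C with ((f w - f a - (w - a) * l) / (w - a))%C by (field; exact E').
apply Rle_lt_trans with (eps / 2); [|lra].
rewrite Cmod_div by exact E'.
apply Rmult_le_reg_r with (Cmod (w - a)); [apply Cmod_gt_0, E'|].
unfold Rdiv at 1; rewrite Rmult_assoc, Rinv_l; [lra|].
apply Rgt_not_eq, Cmod_gt_0, E'.
Qed.

(** * Cauchy's formula *)

(** The contour integral of g along the parabola as a limit over symmetric
    intervals.  It may converge when the improper integral does not, as for
    1 / (z - a).  Integrability on [-T, T] is part of the definition, so that it
    is stable under linear combinations without continuity hypotheses. *)
Definition pv (rho : R) (g : C -> C) (l : C) : Prop :=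
  forall eps, 0 < eps -> exists T0, forall T, T0 <= T -> exists I,
    is_CInt (fun t => g (parabola_path rho t) * - (2 * (rho, t) * Ci))%C (- T) T I
    /\ Cmod (I - l) <= eps.

Lemma pv_ext (rho : R) (g1 g2 : C -> C) (l : C) :
  (forall t, g1 (parabola_path rho t) = g2 (parabola_path rho t)) ->
  pv rho g1 l -> pv rho g2 l.
Proof.
intros E H eps Heps; destruct (H eps Heps) as [T0 HT]; exists T0; intros T HT0.
destruct (HT T HT0) as [I [HI HI2]]; exists I; split; [|exact HI2].
eapply is_CInt_ext; [|exact HI]; intros t; cbv beta; rewrite E; reflexivity.
Qed.

Lemma pv_scal (rho : R) (k : C) (g : C -> C) (l : C) :
  pv rho g l -> pv rho (fun z => k * g z)%C (k * l)%C.
Proof.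
intros H eps Heps.
pose proof (Cmod_ge_0 k) as Hk.
destruct (H (eps / (Cmod k + 1))) as [T0 HT]; [apply Rdiv_lt_0_compat; lra|].
exists T0; intros T HT0; destruct (HT T HT0) as [I [HI HI2]].
exists (k * I)%C; split.
- eapply is_CInt_ext; [|exact (is_CInt_Cmult k _ _ _ _ HI)].
  intros t; cbv beta; ring.
- replace (k * I - k * l)%C with (k * (I - l))%C by ring; rewrite Cmod_mult.
  apply Rle_trans with ((Cmod k + 1) * (eps / (Cmod k + 1))).
  + pose proof (Cmod_ge_0 (I - l)); apply Rmult_le_compat; lra.
  + right; field; lra.
Qed.

Lemma pv_plus (rho : R) (g1 g2 : C -> C) (l1 l2 : C) :
  pv rho g1 l1 -> pv rho g2 l2 -> pv rho (fun z => g1 z + g2 z)%C (l1 + l2)%C.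
Proof.
intros H1 H2 eps Heps.
destruct (H1 (eps / 2)) as [T1 HT1]; [lra|].
destruct (H2 (eps / 2)) as [T2 HT2]; [lra|].
exists (Rmax T1 T2); intros T HT.
pose proof (Rmax_l T1 T2); pose proof (Rmax_r T1 T2).
destruct (HT1 T) as [I1 [HI1 B1]]; [lra|].
destruct (HT2 T) as [I2 [HI2 B2]]; [lra|].
exists (I1 + I2)%C; split.
- eapply is_CInt_ext; [|exact (is_CInt_plus _ _ _ _ _ _ HI1 HI2)].
  intros t; cbv beta; ring.
- replace (I1 + I2 - (l1 + l2))%C with ((I1 - l1) + (I2 - l2))%C by ring.
  eapply Rle_trans; [apply Cmod_triangle|]; lra.
Qed.

(** Differentiability in the closed parabolic region, in the coordinate w. *)
Definition holo_strip (rho : R) (f : C -> C) : Prop :=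
  forall w, 0 <= Re w <= rho -> Cdiff f (- (w * w))%C.

(** f(z) = o(|z|^(1/2)) in the closed parabolic region, in the coordinate w:
    the form in which the growth condition enters all estimates. *)
Definition little_o_strip (rho : R) (f : C -> C) : Prop :=
  forall eps, 0 < eps -> exists M, 0 < M /\ forall w, 0 <= Re w <= rho ->
    M <= Cmod w -> Cmod (f (- (w * w))%C) <= eps * Cmod w.

(** The ray [0, oo) is the image of the imaginary w-axis alone. *)
Lemma Copp_sqr_pos_part (w : C) (a : R) :
  0 < Re w -> 0 <= a -> (- (w * w))%C <> RtoC a.
Proof.
destruct w as [u v]; unfold Copp, Cmult, RtoC; simpl; intros Hu Ha E.
injection E as E1 E2.
assert (v = 0) by nra; subst v; nra.
Qed.

Lemma Cmod_sqr_minus_ge (w : C) (a : R) :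
  0 <= a -> 2 * a <= Cmod w * Cmod w ->
  Cmod w * Cmod w / 2 <= Cmod (- (w * w) - RtoC a).
Proof.
intros Ha Hw.
pose proof (Cmod_triangle (- (w * w) - RtoC a) (RtoC a)) as H.
replace (- (w * w) - RtoC a + RtoC a)%C with (- (w * w))%C in H by ring.
rewrite Cmod_opp, Cmod_mult, Cmod_R, (Rabs_pos_eq a Ha) in H; lra.
Qed.

(** In the coordinate w the form has density h(w) = - 2 w K(- w^2), with K the
    difference quotient: h is odd, its only possible singularity lies on the
    imaginary axis, and it tends to 0 since f(- w^2) = o(|w|) while the
    denominator is of order |w|^2. *)
Lemma pv_diff_quot (rho : R) (f : C -> C) (a : R) (l : C) :
  0 < rho -> holo_strip rho f -> little_o_strip rho f -> 0 <= a ->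
  @is_derive C_AbsRing C_NormedModule f (RtoC a) l ->
  pv rho (diff_quot f (RtoC a) l) (RtoC 0).
Proof.
intros Hrho Hf Ho Ha Hl eps Heps.
set (h := fun w => (diff_quot f (RtoC a) l (- (w * w)) * - (2 * w))%C).
assert (Hsq : forall w, Cdiff (fun w => - (w * w))%C w).
{ intros w; apply Cdiff_opp, Cdiff_mult; apply Cdiff_id. }
assert (Hlin : forall w, Cdiff (fun w => - (2 * w))%C w).
{ intros w; apply Cdiff_opp, Cdiff_mult; [apply Cdiff_const | apply Cdiff_id]. }
assert (Hc : forall w, 0 <= Re w <= rho -> Ccont h w).
{ intros w Hw; unfold h.
  apply Ccont_mult; [|apply Cdiff_Ccont, Hlin].
  apply (Ccont_comp (diff_quot f (RtoC a) l)).
  - apply Ccont_diff_quot; [exact Hl | apply Hf, Hw].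
  - apply Cdiff_Ccont, Hsq. }
destruct (strip_int_cv0 h rho) with (eps := eps) as [T0 HT0]; try assumption.
- intros w Hw; apply Cdiff_mult; [|apply Hlin].
  apply (Cdiff_comp (diff_quot f (RtoC a) l)); [|apply Hsq].
  apply Cdiff_diff_quot; [apply Copp_sqr_pos_part; lra | apply Hf; lra].
- intros w; unfold h.
  replace (- - w * - w)%C with (- (w * w))%C by ring.
  replace (- (- w * - w))%C with (- (w * w))%C by ring; ring.
- clear eps Heps; intros eps Heps.
  (* For |w| >= M and |w| >= 8 |f(a)| / eps the numerator is at most
     (eps/8 + eps/8) |w|; for |w|^2 >= 2 a the denominator is at least
     |w|^2 / 2; with the factor 2 |w| this gives eps. *)
  destruct (Ho (eps / 8)) as [M [HM HMo]]; [lra|].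
  pose proof (Cmod_ge_0 (f (RtoC a))) as Hfa.
  exists (M + 2 * a + 1 + 8 * Cmod (f (RtoC a)) / eps).
  intros w Hw Him.
  assert (Hq : 0 <= 8 * Cmod (f (RtoC a)) / eps).
  { apply Rmult_le_pos; [lra|]; apply Rlt_le, Rinv_0_lt_compat, Heps. }
  pose proof (im_le_Cmod w) as Hm.
  set (m := Cmod w) in *.
  assert (Hm1 : 1 <= m) by lra.
  assert (H8 : 8 * Cmod (f (RtoC a)) <= eps * m).
  { apply Rle_trans with (eps * (8 * Cmod (f (RtoC a)) / eps)); [right; field; lra|].
    apply Rmult_le_compat_l; lra. }
  assert (Hma : 2 * a <= m * m) by nra.
  pose proof (Cmod_sqr_minus_ge w a Ha Hma) as Hden; fold m in Hden.
  assert (Hden0 : 0 < Cmod (- (w * w) - RtoC a)) by nra.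
  unfold h, diff_quot.
  destruct (Ceq_dec (- (w * w)) (RtoC a)) as [E | E].
  { rewrite E in Hden0; unfold Cminus in Hden0; rewrite Cplus_opp_r, Cmod_0 in Hden0; lra. }
  rewrite Cmod_mult, Cmod_div by (apply Cmod_gt_0; exact Hden0).
  rewrite Cmod_opp, Cmod_mult, Cmod_R, Rabs_pos_eq by lra; fold m.
  set (den := Cmod (- (w * w) - RtoC a)) in *.
  assert (Hnum : Cmod (f (- (w * w)) - f (RtoC a))%C <= eps / 4 * m).
  { eapply Rle_trans; [apply Cmod_triangle|]; rewrite Cmod_opp.
    specialize (HMo w Hw); fold m in HMo.
    assert (M <= m) by lra. specialize (HMo ltac:(assumption)); lra. }
  apply Rmult_le_reg_r with den; [exact Hden0|].
  replace (Cmod (f (- (w * w)) - f (RtoC a))%C / den * (2 * m) * den)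
    with (Cmod (f (- (w * w)) - f (RtoC a))%C * (2 * m)) by (field; lra).
  apply Rle_trans with (eps / 4 * m * (2 * m)); [apply Rmult_le_compat_r; lra|].
  nra.
- exists (Rmax T0 0); intros T HT.
  pose proof (Rmax_l T0 0); pose proof (Rmax_r T0 0).
  exists (Ci * CInt (fun t => h (rho, t)) (- T) T)%C; split.
  + eapply is_CInt_ext; [|apply is_CInt_Cmult, CInt_correct, (ex_CInt_ver h); [lra|]].
    * intros t; unfold h, parabola_path; ring.
    * intros y _; apply Hc; simpl; lra.
  + unfold Cminus; replace (- RtoC 0)%C with (RtoC 0) by ring.
    rewrite Cplus_0_r, Cmod_mult, Cmod_Ci, Rmult_1_l; apply HT0; lra.
Qed.

Lemma pair_neq_0 (u v : R) : 0 < u -> ((u, v) : C) <> RtoC 0.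
Proof. intros Hu E; apply (f_equal fst) in E; simpl in E; lra. Qed.

(** i / (rho + i s) = (s + i rho) / (rho^2 + s^2), with primitive
    ln(rho^2 + s^2) / 2 + i atan(s / rho). *)
Lemma is_CInt_Ci_div (rho k a b : R) : 0 < rho ->
  is_CInt (fun t => Ci / ((rho, t + k)%R : C))%C a b
    ((ln (rho * rho + (b + k) * (b + k)) / 2 - ln (rho * rho + (a + k) * (a + k)) / 2)%R,
     (atan ((b + k) / rho) - atan ((a + k) / rho))%R).
Proof.
intros Hrho.
assert (Hp : forall t, 0 < rho * rho + (t + k) * (t + k)) by (intros t; pose proof (Rle_0_sqr (t + k)) as Ht; unfold Rsqr in Ht; nra).
assert (E : forall t, ((t + k) / (rho * rho + (t + k) * (t + k)), rho / (rho * rho + (t + k) * (t + k)))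
  = (Ci / ((rho, t + k)%R : C))%C).
{ intros t; specialize (Hp t); unfold Cdiv, Cinv, Ci, Cmult; simpl; f_equal; field; lra. }
eapply is_CInt_ext; [exact E|].
apply (@is_RInt_fct_extend_pair R_NormedModule R_NormedModule); simpl.
- apply (is_RInt_derive (V := R_CompleteNormedModule) (fun t => ln (rho * rho + (t + k) * (t + k)) / 2)).
  + intros t _; specialize (Hp t); auto_derive; [exact Hp | field; lra].
  + intros t _; specialize (Hp t); apply (ex_derive_continuous (V := R_NormedModule)); auto_derive; lra.
- apply (is_RInt_derive (V := R_CompleteNormedModule) (fun t => atan ((t + k) / rho))).
  + intros t _; specialize (Hp t); auto_derive; [exact I | field; split; [|lra]].
    unfold Rsqr; nra.
  + intros t _; specialize (Hp t); apply (ex_derive_continuous (V := R_NormedModule)); auto_derive; lra.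
Qed.

Lemma atan_cv_PI2 (eps : R) : 0 < eps -> exists S, forall s, S <= s -> PI / 2 - eps <= atan s.
Proof.
intros He.
set (e := Rmin eps 1).
assert (He0 : 0 < e) by (apply Rmin_pos; lra).
pose proof (Rmin_l eps 1 : e <= eps); pose proof (Rmin_r eps 1 : e <= 1).
pose proof PI2_1.
exists (tan (PI / 2 - e)); intros s [Hs | <-].
- apply atan_increasing in Hs; rewrite atan_tan in Hs; lra.
- rewrite atan_tan; lra.
Qed.

(** With b = sqrt(a) the form dz / (z - a) is dw / (w + i b) + dw / (w - i b).
    Over a symmetric segment the logarithms of the two primitives cancel, and
    each of the four arctangents tends to PI / 2. *)
Lemma pv_Cauchy_kernel (rho a : R) : 0 < rho -> 0 <= a ->
  pv rho (fun z => / (z - RtoC a))%C (2 * PI * Ci)%C.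
Proof.
intros Hrho Ha eps Heps.
set (b := sqrt a).
assert (Hb : 0 <= b) by apply sqrt_pos.
assert (Hb2 : b * b = a) by (apply sqrt_sqrt, Ha).
destruct (atan_cv_PI2 (eps / 4)) as [S HS]; [lra|].
exists (rho * Rabs S + b); intros T HT.
set (J := (2 * (atan ((T + b) / rho) + atan ((T - b) / rho)))%R).
exists (0, J); split.
- pose proof (is_CInt_plus _ _ _ _ _ _ (is_CInt_Ci_div rho b (- T) T Hrho)
    (is_CInt_Ci_div rho (- b) (- T) T Hrho)) as HI.
  match type of HI with is_RInt _ _ _ ?l => replace l with ((0, J) : C) in HI end.
  + eapply is_CInt_ext; [|exact HI].
    intros t; unfold parabola_path.
    set (p := (rho, t + b)%R : C); set (q := (rho, t + - b)%R : C).
    assert (Hp : p <> RtoC 0) by (apply pair_neq_0, Hrho).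
    assert (Hq : q <> RtoC 0) by (apply pair_neq_0, Hrho).
    replace (- ((rho, t) * (rho, t)) - RtoC a)%C with (- (p * q))%C.
    2: { unfold p, q, Cmult, Cminus, Cplus, Copp, RtoC; simpl; f_equal; [rewrite <- Hb2|]; ring. }
    replace (2 * (rho, t))%C with (p + q)%C
      by (unfold p, q, Cmult, Cplus, RtoC; simpl; f_equal; ring).
    field; split; assumption.
  + unfold J, Cplus; simpl; f_equal.
    * replace ((- T + b) * (- T + b)) with ((T + - b) * (T + - b)) by ring.
      replace ((- T + - b) * (- T + - b)) with ((T + b) * (T + b)) by ring; ring.
    * replace ((- T + b) / rho) with (- ((T - b) / rho)) by (field; lra).
      replace ((- T + - b) / rho) with (- ((T + b) / rho)) by (field; lra).
      rewrite !atan_opp; unfold Rminus; ring.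
- assert (Hlow : forall s, T - b <= s -> PI / 2 - eps / 4 <= atan (s / rho)).
  { intros s Hs; apply HS; apply Rle_trans with (Rabs S); [apply Rle_abs|].
    apply Rmult_le_reg_r with rho; [exact Hrho|].
    unfold Rdiv; rewrite Rmult_assoc, Rinv_l; lra. }
  pose proof (Hlow (T + b) ltac:(lra)); pose proof (Hlow (T - b) ltac:(lra)).
  pose proof (atan_bound ((T + b) / rho)); pose proof (atan_bound ((T - b) / rho)).
  replace ((0, J) - 2 * PI * Ci)%C with (Ci * RtoC (J - 2 * PI))%C
    by (unfold Cminus, Cmult, Cplus, Copp, Ci, RtoC; simpl; f_equal; ring).
  rewrite Cmod_mult, Cmod_Ci, Cmod_R, Rmult_1_l.
  apply Rabs_le; unfold J; lra.
Qed.

Lemma parabola_path_neq (rho t a : R) :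
  0 < rho -> 0 <= a -> parabola_path rho t <> RtoC a.
Proof. intros Hrho Ha; apply Copp_sqr_pos_part; [exact Hrho | exact Ha]. Qed.

(** The value at a splits off: f(z) = (f(z) - f(a)) + f(a). *)
Lemma pv_Cauchy (rho : R) (f : C -> C) (a : R) :
  0 < rho -> holo_strip rho f -> little_o_strip rho f -> 0 <= a ->
  pv rho (fun z => f z / (z - RtoC a))%C (2 * PI * Ci * f (RtoC a))%C.
Proof.
intros Hrho Hf Ho Ha.
destruct (Hf (0, sqrt a)) as [l Hl]; [simpl; lra|].
replace (- ((0, sqrt a) * (0, sqrt a)))%C with (RtoC a) in Hl.
2: { unfold Copp, Cmult, RtoC; simpl; f_equal; [|ring].
     rewrite sqrt_sqrt by exact Ha; ring. }
pose proof (pv_diff_quot rho f a l Hrho Hf Ho Ha Hl) as H1.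
pose proof (pv_scal rho (f (RtoC a)) _ _ (pv_Cauchy_kernel rho a Hrho Ha)) as H2.
pose proof (pv_plus _ _ _ _ _ H1 H2) as H3.
replace (RtoC 0 + f (RtoC a) * (2 * PI * Ci))%C with (2 * PI * Ci * f (RtoC a))%C in H3 by ring.
eapply pv_ext; [|exact H3].
intros t; unfold diff_quot.
pose proof (parabola_path_neq rho t a Hrho Ha) as Hn.
destruct (Ceq_dec _ _) as [E | _]; [contradiction|].
field; apply Cminus_neq_0, Hn.
Qed.

(** * Polynomial interpolation *)

Lemma poly_sum_S (a : nat -> C) (n : nat) (z : C) :
  @sum_n C_AbelianMonoid (fun k => a k * z ^ k)%C (S n) =
  (@sum_n C_AbelianMonoid (fun k => a k * z ^ k)%C n + a (S n) * z ^ S n)%C.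
Proof. apply (@sum_Sn C_AbelianMonoid). Qed.

Lemma poly_sum_0 (a : nat -> C) (z : C) :
  @sum_n C_AbelianMonoid (fun k => a k * z ^ k)%C 0 = a O.
Proof. rewrite (@sum_O C_AbelianMonoid); simpl; ring. Qed.

Lemma poly_deg_le_ext (n : nat) (p q : C -> C) :
  (forall z, p z = q z) -> poly_deg_le n p -> poly_deg_le n q.
Proof. intros E [a Ha]; exists a; intros z; rewrite <- E; apply Ha. Qed.

Lemma poly_deg_le_const (k : C) : poly_deg_le 0 (fun _ => k).
Proof. exists (fun _ => k); intros z; rewrite poly_sum_0; reflexivity. Qed.

Lemma poly_deg_le_lin (n : nat) (k : C) (p q : C -> C) :
  poly_deg_le n p -> poly_deg_le n q -> poly_deg_le n (fun z => p z + k * q z)%C.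
Proof.
intros [a Ha] [b Hb]; exists (fun j => a j + k * b j)%C.
intros z; rewrite Ha, Hb; clear.
induction n as [|n IH]; [rewrite !poly_sum_0; reflexivity|].
rewrite !poly_sum_S, <- IH; ring.
Qed.

Lemma poly_deg_le_S (n : nat) (p : C -> C) : poly_deg_le n p -> poly_deg_le (S n) p.
Proof.
intros [a Ha]; exists (fun j => if Nat.leb j n then a j else RtoC 0).
intros z; rewrite Ha, poly_sum_S.
replace (Nat.leb (S n) n) with false by (symmetry; apply Nat.leb_gt; lia).
rewrite Cmult_0_l, Cplus_0_r.
apply (@sum_n_ext_loc C_AbelianMonoid); intros k Hk.
replace (Nat.leb k n) with true by (symmetry; apply Nat.leb_le; exact Hk); reflexivity.
Qed.

Lemma poly_deg_le_shift (n : nat) (p : C -> C) :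
  poly_deg_le n p -> poly_deg_le (S n) (fun z => z * p z)%C.
Proof.
intros [a Ha]; exists (fun j => match j with O => RtoC 0 | S i => a i end).
intros z; rewrite Ha; clear.
induction n as [|n IH].
- rewrite poly_sum_S, !poly_sum_0; simpl; ring.
- rewrite (poly_sum_S _ (S n)), <- IH, poly_sum_S; simpl; ring.
Qed.

Lemma poly_deg_le_mul_root (n : nat) (s : C) (p : C -> C) :
  poly_deg_le n p -> poly_deg_le (S n) (fun z => p z * (z - s))%C.
Proof.
intros H.
apply (poly_deg_le_ext _ (fun z => z * p z + (- s) * p z)%C); [intros z; ring|].
apply poly_deg_le_lin; [apply poly_deg_le_shift, H | apply poly_deg_le_S, H].
Qed.

Lemma poly_deg_le_div (n : nat) (s : C) (p : C -> C) :
  poly_deg_le (S n) p ->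
  exists q r, poly_deg_le n q /\ forall z, p z = (q z * (z - s) + r)%C.
Proof.
revert p; induction n as [|n IH]; intros p [a Ha].
- exists (fun _ => a 1%nat), (a O + a 1%nat * s)%C; split; [apply poly_deg_le_const|].
  intros z; rewrite Ha, poly_sum_S, poly_sum_0; ring.
- (* Subtracting the top coefficient times z^(n+1) (z - s) lowers the degree. *)
  set (b := fun j => if Nat.eqb j (S n) then (a (S n) + a (S (S n)) * s)%C else a j).
  assert (Hb : forall z, p z = (a (S (S n)) * z ^ S n * (z - s)
     + @sum_n C_AbelianMonoid (fun k => b k * z ^ k)%C (S n))%C).
  { intros z; rewrite Ha, !poly_sum_S.
    replace (@sum_n C_AbelianMonoid (fun k => b k * z ^ k)%C n) with
      (@sum_n C_AbelianMonoid (fun k => a k * z ^ k)%C n).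
    - unfold b; rewrite Nat.eqb_refl; simpl; ring.
    - apply (@sum_n_ext_loc C_AbelianMonoid); intros k Hk; unfold b.
      replace (Nat.eqb k (S n)) with false by (symmetry; apply Nat.eqb_neq; lia); reflexivity. }
  destruct (IH (fun z => @sum_n C_AbelianMonoid (fun k => b k * z ^ k)%C (S n))) as [q [r [Hq Hr]]].
  { exists b; reflexivity. }
  exists (fun z => q z + a (S (S n)) * z ^ S n)%C, r; split.
  + apply poly_deg_le_lin; [apply poly_deg_le_S, Hq|].
    exists (fun j => if Nat.eqb j (S n) then RtoC 1 else RtoC 0).
    intros z; rewrite poly_sum_S, Nat.eqb_refl.
    replace (@sum_n C_AbelianMonoid _ n) with (RtoC 0); [ring|].
    symmetry; transitivity (@sum_n C_AbelianMonoid (fun k => RtoC 0 * z ^ k)%C n).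
    * apply (@sum_n_ext_loc C_AbelianMonoid); intros k Hk.
      replace (Nat.eqb k (S n)) with false by (symmetry; apply Nat.eqb_neq; lia); reflexivity.
    * clear; induction n as [|n IH]; [apply poly_sum_0|].
      rewrite (poly_sum_S (fun _ => RtoC 0)), IH; ring.
  + intros z; rewrite Hb, Hr; ring.
Qed.

Definition distinct_nodes (n : nat) (x : nat -> R) : Prop :=
  forall i j, (i < j)%nat -> (j <= n)%nat -> x i <> x j.

Lemma distinct_nodes_pred (n : nat) (x : nat -> R) :
  distinct_nodes (S n) x -> distinct_nodes n x.
Proof. intros H i j Hi Hj; apply H; lia. Qed.

Lemma RtoC_minus_neq_0 (a b : R) : a <> b -> (RtoC a - RtoC b)%C <> RtoC 0.
Proof. intros H; apply Cminus_neq_0; intros E; apply H, RtoC_inj, E. Qed.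

(** By induction on the degree: dividing by z minus the last node leaves a
    polynomial of lower degree that vanishes at the other nodes. *)
Lemma poly_vanishing (n : nat) (x : nat -> R) (p : C -> C) :
  distinct_nodes n x -> poly_deg_le n p ->
  (forall j, (j <= n)%nat -> p (RtoC (x j)) = RtoC 0) -> forall z, p z = RtoC 0.
Proof.
revert p; induction n as [|n IH]; intros p Hx Hp H0 z.
- destruct Hp as [a Ha].
  rewrite Ha, poly_sum_0, <- (poly_sum_0 a (RtoC (x O))), <- Ha; apply H0; lia.
- destruct (poly_deg_le_div n (RtoC (x (S n))) p Hp) as [q [r [Hq E]]].
  assert (Hr : r = RtoC 0).
  { rewrite <- (H0 (S n) (le_n _)), E; ring. }
  rewrite E, Hr, (IH q); [ring | apply distinct_nodes_pred, Hx | exact Hq |].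
  intros j Hj.
  pose proof (H0 j ltac:(lia)) as Hj0; rewrite E, Hr in Hj0.
  assert (Hne : (RtoC (x j) - RtoC (x (S n)))%C <> RtoC 0).
  { apply RtoC_minus_neq_0, Hx; lia. }
  replace (q (RtoC (x j))) with ((q (RtoC (x j)) * (RtoC (x j) - RtoC (x (S n))) + RtoC 0)
    / (RtoC (x j) - RtoC (x (S n))))%C by (field; exact Hne).
  rewrite Hj0; unfold Cdiv; ring.
Qed.

Lemma interpolant_unique (n : nat) (x : nat -> R) (f p q : C -> C) :
  distinct_nodes n x -> interpolant n x f p -> interpolant n x f q ->
  forall z, q z = p z.
Proof.
intros Hx [Hp1 Hp2] [Hq1 Hq2] z.
pose proof (poly_vanishing n x (fun z => q z + (- (1)) * p z)%C Hx) as H.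
cbv beta in H.
replace (q z) with (q z + (- (1)) * p z + p z)%C by ring.
rewrite H; [ring | apply poly_deg_le_lin; assumption |].
intros j Hj; rewrite Hp2, Hq2 by exact Hj; ring.
Qed.

Definition node_prod (n : nat) (x : nat -> R) (z : C) : C :=
  Cprod_n (fun j => z - RtoC (x j))%C n.

Lemma node_prod_neq_0 (n : nat) (x : nat -> R) (z : C) :
  (forall j, (j <= n)%nat -> z <> RtoC (x j)) -> node_prod n x z <> RtoC 0.
Proof.
unfold node_prod; induction n as [|n IH]; intros H; simpl.
- apply Cminus_neq_0, H; lia.
- apply Cmult_neq_0; [apply IH; intros; apply H; lia | apply Cminus_neq_0, H; lia].
Qed.

Lemma node_prod_root (n : nat) (x : nat -> R) (j : nat) :
  (j <= n)%nat -> node_prod n x (RtoC (x j)) = RtoC 0.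
Proof.
unfold node_prod; induction n as [|n IH]; intros Hj; simpl.
- replace j with O by lia; ring.
- destruct (Nat.eq_dec j (S n)) as [-> | Hne]; [ring|].
  rewrite IH by lia; ring.
Qed.

Lemma node_prod_deg (n : nat) (x : nat -> R) : poly_deg_le (S n) (node_prod n x).
Proof.
unfold node_prod; induction n as [|n IH]; simpl.
- apply (poly_deg_le_ext _ (fun z => RtoC 1 * (z - RtoC (x O)))%C); [intros; ring|].
  apply poly_deg_le_mul_root, poly_deg_le_const.
- apply (poly_deg_le_mul_root _ _ _ IH).
Qed.

(** Newton's form of the interpolation polynomial, which is compatible with the
    induction on the number of nodes in [pv_Hermite]. *)
Fixpoint newton (f : C -> C) (x : nat -> R) (n : nat) (z : C) : C :=
  match n with
  | O => f (RtoC (x O))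
  | S m => (newton f x m z + (f (RtoC (x n)) - newton f x m (RtoC (x n)))
              / node_prod m x (RtoC (x n)) * node_prod m x z)%C
  end.

Lemma newton_interpolant (n : nat) (x : nat -> R) (f : C -> C) :
  distinct_nodes n x -> interpolant n x f (newton f x n).
Proof.
induction n as [|n IH]; intros Hx.
- split; [apply poly_deg_le_const|].
  intros j Hj; replace j with O by lia; reflexivity.
- destruct (IH (distinct_nodes_pred n x Hx)) as [Hd Hi]; split.
  + apply (poly_deg_le_lin (S n)); [apply poly_deg_le_S, Hd | apply node_prod_deg].
  + intros j Hj; simpl.
    destruct (Nat.eq_dec j (S n)) as [-> | Hne].
    * field; apply node_prod_neq_0; intros i Hin E.
      apply RtoC_inj in E; apply (Hx i (S n)); [lia | lia | now symmetry].
    * rewrite (node_prod_root n x j), Hi by lia; ring.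
Qed.

(** * Hermite's formula *)

(** Partial fractions in the two simple poles s and y: adding a node to the
    integrand acts on integrals as a divided difference. *)
Lemma pv_div_diff (rho : R) (g : C -> C) (s y : R) (ls ly : C) :
  0 < rho -> 0 <= s -> 0 <= y -> y <> s ->
  pv rho (fun z => g z / (z - RtoC s))%C ls ->
  pv rho (fun z => g z / (z - RtoC y))%C ly ->
  pv rho (fun z => g z / ((z - RtoC s) * (z - RtoC y)))%C
    ((ly - ls) / (RtoC y - RtoC s))%C.
Proof.
intros Hrho Hs Hy Hys Hls Hly.
pose proof (RtoC_minus_neq_0 y s Hys) as Hd.
pose proof (pv_scal _ (/ (RtoC y - RtoC s))%C _ _
  (pv_plus _ _ _ _ _ Hly (pv_scal _ (- (1))%C _ _ Hls))) as H.
match type of H with pv _ _ ?l =>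
  replace l with ((ly - ls) / (RtoC y - RtoC s))%C in H by (field; exact Hd) end.
eapply pv_ext; [|exact H].
intros t; cbv beta.
pose proof (Cminus_neq_0 _ _ (parabola_path_neq rho t y Hrho Hy)).
pose proof (Cminus_neq_0 _ _ (parabola_path_neq rho t s Hrho Hs)).
field; repeat split; assumption.
Qed.

(** Newton's form makes E_n = (f - p_n) / phi_n satisfy
    E_(n+1)(y) = (E_n(y) - E_n(s)) / (y - s) for the new node s, and the
    integrals satisfy the same recursion by [pv_div_diff].  The first step,
    E_0(y) = (f(y) - f(x_0)) / (y - x_0), comes from Cauchy's formula at the
    two points. *)
Lemma pv_Hermite (rho : R) (f : C -> C) (n : nat) (x : nat -> R) :
  0 < rho -> holo_strip rho f -> little_o_strip rho f ->
  distinct_nodes n x -> (forall j, (j <= n)%nat -> 0 <= x j) ->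
  forall y, 0 <= y -> (forall j, (j <= n)%nat -> y <> x j) ->
  pv rho (fun z => f z / (node_prod n x z * (z - RtoC y)))%C
    (2 * PI * Ci * ((f (RtoC y) - newton f x n (RtoC y)) / node_prod n x (RtoC y)))%C.
Proof.
intros Hrho Hf Ho; induction n as [|n IH]; intros Hx Hx0 y Hy Hyx.
- assert (Hs : 0 <= x O) by (apply Hx0; lia).
  assert (Hys : y <> x O) by (apply Hyx; lia).
  pose proof (pv_div_diff rho f (x O) y _ _ Hrho Hs Hy Hys
    (pv_Cauchy rho f (x O) Hrho Hf Ho Hs) (pv_Cauchy rho f y Hrho Hf Ho Hy)) as H.
  match type of H with pv _ _ ?l => replace l with
    (2 * PI * Ci * ((f (RtoC y) - newton f x 0 (RtoC y)) / node_prod 0 x (RtoC y)))%C in H end.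
  2: { unfold node_prod; simpl; field; apply RtoC_minus_neq_0, Hys. }
  exact H.
- specialize (IH (distinct_nodes_pred n x Hx) (fun j Hj => Hx0 j (le_S _ _ Hj))).
  set (s := x (S n)) in *.
  assert (Hs : 0 <= s) by (apply Hx0; lia).
  assert (Hys : y <> s) by (apply Hyx; lia).
  assert (Hsx : forall j, (j <= n)%nat -> s <> x j).
  { intros j Hj E; apply (Hx j (S n)); [lia | lia | now symmetry]. }
  assert (Hgr : forall v l, 0 <= v ->
    pv rho (fun z => f z / (node_prod n x z * (z - RtoC v)))%C l ->
    pv rho (fun z => f z / node_prod n x z / (z - RtoC v))%C l).
  { intros v l Hv; apply pv_ext; intros t.
    pose proof (Cminus_neq_0 _ _ (parabola_path_neq rho t v Hrho Hv)).
    assert (node_prod n x (parabola_path rho t) <> RtoC 0).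
    { apply node_prod_neq_0; intros j Hj; apply parabola_path_neq; [exact Hrho | apply Hx0; lia]. }
    field; split; assumption. }
  pose proof (pv_div_diff rho (fun z => f z / node_prod n x z)%C s y _ _ Hrho Hs Hy Hys
    (Hgr s _ Hs (IH s Hs Hsx))
    (Hgr y _ Hy (IH y Hy (fun j Hj => Hyx j (le_S _ _ Hj))))) as H.
  assert (Hpy : node_prod n x (RtoC y) <> RtoC 0).
  { apply node_prod_neq_0; intros j Hj E; apply RtoC_inj in E; apply (Hyx j); [lia | exact E]. }
  assert (Hps : node_prod n x (RtoC s) <> RtoC 0).
  { apply node_prod_neq_0; intros j Hj E; apply RtoC_inj in E; apply (Hsx j Hj E). }
  match type of H with pv _ _ ?l => replace l with
    (2 * PI * Ci * ((f (RtoC y) - newton f x (S n) (RtoC y)) / node_prod (S n) x (RtoC y)))%C in H end.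
  2: { change (node_prod (S n) x (RtoC y)) with (node_prod n x (RtoC y) * (RtoC y - RtoC s))%C.
       pose proof (RtoC_minus_neq_0 y s Hys).
       simpl newton; fold s; field; repeat split; assumption. }
  eapply pv_ext; [|exact H].
  intros t; cbv beta.
  change (node_prod (S n) x (parabola_path rho t)) with
    (node_prod n x (parabola_path rho t) * (parabola_path rho t - RtoC s))%C.
  pose proof (Cminus_neq_0 _ _ (parabola_path_neq rho t y Hrho Hy)).
  pose proof (Cminus_neq_0 _ _ (parabola_path_neq rho t s Hrho Hs)).
  assert (node_prod n x (parabola_path rho t) <> RtoC 0).
  { apply node_prod_neq_0; intros j Hj; apply parabola_path_neq; [exact Hrho | apply Hx0; lia]. }
  field; repeat split; assumption.
Qed.

(** * From the principal value to the improper integral *)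

Lemma is_RInt_inv_sqr (B a b : R) : a <= b -> (0 < a \/ b < 0) ->
  is_RInt (fun t => B / (t * t)) a b (B / a - B / b).
Proof.
intros Hab H0.
replace (B / a - B / b) with (minus (- (B / b)) (- (B / a))).
2: { change (- (B / b) - - (B / a) = B / a - B / b); ring. }
apply (is_RInt_derive (V := R_CompleteNormedModule) (fun t => - (B / t)));
  rewrite Rmin_left, Rmax_right by exact Hab; intros t Ht; assert (t <> 0) by lra.
- auto_derive; [assumption | field; assumption].
- apply (ex_derive_continuous (V := R_NormedModule)); auto_derive.
  apply Rmult_integral_contrapositive; split; assumption.
Qed.

Lemma is_CInt_inv_sqr_bound (g : R -> C) (B a b : R) (l : C) :
  a <= b -> (0 < a \/ b < 0) ->
  (forall t, a <= t <= b -> Cmod (g t) <= B / (t * t)) ->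
  is_CInt g a b l -> Cmod l <= B / a - B / b.
Proof.
intros Hab H0 Hg Hl; rewrite Cmod_norm.
apply (@norm_RInt_le C_R_NormedModule g (fun t => B / (t * t)) a b); [exact Hab | | exact Hl |].
- intros t Ht; specialize (Hg t Ht); rewrite Cmod_norm in Hg; exact Hg.
- apply is_RInt_inv_sqr; assumption.
Qed.

(** The improper integral lets both ends go to infinity independently.  The
    parts outside [-T, T] are at most 2 B / T when g is bounded by B / t^2, so
    it is enough to know the symmetric integrals. *)
Lemma is_RInt_gen_of_symmetric (g : R -> C) (B T1 : R) (l : C) :
  (forall a b, a <= b -> ex_CInt g a b) ->
  0 <= B -> (forall t, T1 <= Rabs t -> Cmod (g t) <= B / (t * t)) ->
  (forall eps, 0 < eps -> exists T0, forall T, T0 <= T -> exists I,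
     is_CInt g (- T) T I /\ Cmod (I - l) <= eps) ->
  @is_RInt_gen C_R_NormedModule g (Rbar_locally m_infty) (Rbar_locally p_infty) l.
Proof.
intros Hex HB Hdec Hpv; apply filterlimi_locally; intros [eps Heps].
destruct (Hpv (eps / 4)) as [T0 HT0]; [lra|].
set (T := Rmax (Rmax T0 T1) (1 + 4 * B / eps)).
assert (HTa : T0 <= T) by (unfold T; eapply Rle_trans; [apply Rmax_l|apply Rmax_l]).
assert (HTb : T1 <= T) by (unfold T; eapply Rle_trans; [apply Rmax_r|apply Rmax_l]).
assert (HTc : 1 + 4 * B / eps <= T) by apply Rmax_r.
assert (Hq : 0 <= 4 * B / eps).
{ apply Rmult_le_pos; [lra|]; apply Rlt_le, Rinv_0_lt_compat, Heps. }
assert (HTB : B / T <= eps / 4).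
{ apply Rmult_le_reg_r with T; [lra|].
  unfold Rdiv at 1; rewrite Rmult_assoc, Rinv_l, Rmult_1_r by lra.
  apply Rle_trans with (eps / 4 * (4 * B / eps)); [right; field; lra|].
  apply Rmult_le_compat_l; lra. }
destruct (HT0 T HTa) as [I [HI HIl]].
exists (fun a => a < - T) (fun b => T < b).
{ exists (- T); intros a Ha; exact Ha. }
{ exists T; intros b Hb; exact Hb. }
intros a b Ha Hb; simpl.
pose proof (CInt_correct g a (- T) (Hex a (- T) ltac:(lra))) as HL.
pose proof (CInt_correct g T b (Hex T b ltac:(lra))) as HR.
revert HL HR; generalize (CInt g a (- T)) (CInt g T b); intros L R' HL HR.
exists (L + I + R')%C; split.
{ exact (is_CInt_Chasles _ _ _ _ _ _ (is_CInt_Chasles _ _ _ _ _ _ HL HI) HR). }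
assert (BL : Cmod L <= B / a - B / (- T)).
{ apply (is_CInt_inv_sqr_bound g); [lra | right; lra | | exact HL].
  intros t Ht; apply Hdec; rewrite Rabs_left; lra. }
assert (BR : Cmod R' <= B / T - B / b).
{ apply (is_CInt_inv_sqr_bound g); [lra | left; lra | | exact HR].
  intros t Ht; apply Hdec; rewrite Rabs_pos_eq; lra. }
assert (0 <= B / b) by (apply Rmult_le_pos; [lra|]; apply Rlt_le, Rinv_0_lt_compat; lra).
assert (B / a <= 0).
{ replace (B / a) with (- (B / - a)) by (field; lra).
  assert (0 <= B / - a) by (apply Rmult_le_pos; [lra|]; apply Rlt_le, Rinv_0_lt_compat; lra).
  lra. }
replace (B / - T) with (- (B / T)) in BL by (field; lra).
apply C_NormedModule_mixin_compat1.
change (Cmod (L + I + R' - l)%C < eps).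
replace (L + I + R' - l)%C with (L + R' + (I - l))%C by ring.
pose proof (Cmod_triangle (L + R') (I - l)).
pose proof (Cmod_triangle L R').
lra.
Qed.

(** The remainder of the linear approximation is exactly (s - t)^2. *)
Lemma is_derive_parabola_path (rho t : R) :
  @is_derive R_AbsRing C_R_NormedModule (parabola_path rho) t (- (2 * (rho, t) * Ci))%C.
Proof.
split; [apply is_linear_scal_l|].
intros x Hx eps.
assert (E : t = x) by exact (@is_filter_lim_locally_unique R_AbsRing R_NormedModule t x Hx).
subst x; exists eps; intros s Hs.
change (Rabs (s - t) < eps) in Hs.
change (norm (minus s t)) with (Rabs (s - t)).
match goal with |- norm ?u <= _ => replace u with (RtoC ((s - t) * (s - t))) end.
2: { apply injective_projections; unfold minus, plus, opp, scal; simpl;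
     unfold prod_scal, scal, mult; simpl; unfold mult, plus, opp; simpl; ring. }
match goal with |- ?u <= _ => change u with (norm (RtoC ((s - t) * (s - t)) : C_R_NormedModule)) end.
rewrite <- Cmod_norm, Cmod_R, Rabs_mult.
apply Rmult_le_compat_r; [apply Rabs_pos | lra].
Qed.

Lemma contour_int_of_pv (rho : R) (g : C -> C) (B T1 : R) (l : C) :
  (forall t, Cdiff g (parabola_path rho t)) -> 0 <= B ->
  (forall t, T1 <= Rabs t ->
     Cmod (g (parabola_path rho t) * - (2 * (rho, t) * Ci)) <= B / (t * t)) ->
  pv rho g l -> is_contour_int (parabola_path rho) g l.
Proof.
intros Hg HB Hdec Hpv.
exists (fun t => - (2 * (rho, t) * Ci))%C; split; [apply is_derive_parabola_path|].
apply (is_RInt_gen_of_symmetric _ B T1); [|exact HB | exact Hdec | exact Hpv].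
intros a b Hab.
apply (ex_CInt_ver (fun w => g (- (w * w)) * - (2 * w * Ci))%C a b rho Hab).
intros y _; apply Cdiff_Ccont, Cdiff_mult.
- apply (Cdiff_comp g); [apply Hg|].
  apply Cdiff_opp, Cdiff_mult; apply Cdiff_id.
- apply Cdiff_opp, Cdiff_mult; [|apply Cdiff_const].
  apply Cdiff_mult; [apply Cdiff_const | apply Cdiff_id].
Qed.

(** * Growth and decay along the parabola *)

(** On the right half-plane w is the branch sqrt(-z) at z = - w^2, so the
    parabolic region is the image of the strip. *)
Lemma Re_sqrt_neg_opp_sqr (w : C) : 0 <= Re w -> Re (sqrt_neg (- (w * w))) = Re w.
Proof.
intros Hw; unfold sqrt_neg.
replace (- - (w * w))%C with (w * w)%C by ring.
unfold Csqrt; rewrite Cmod_mult, Cmod_sqr; unfold Re at 1; simpl.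
replace (_ / 2) with (Re w * Re w); [apply sqrt_square, Hw|].
unfold Re, Im; simpl; field.
Qed.

Lemma analytic_near_holo_strip (rho : R) (f : C -> C) :
  analytic_near f (fun z => parabola_interior rho z \/ parabola rho z) ->
  holo_strip rho f.
Proof.
intros [U [_ [HU Hf]]] w [Hw0 Hw]; apply Hf, HU.
unfold parabola_interior, parabola; rewrite Re_sqrt_neg_opp_sqr by exact Hw0.
destruct Hw; [left | right]; assumption.
Qed.

(** In terms of ln m the claim reads ln(K / eps) <= (1 - 2 beta) ln m; the sign
    of 1 - 2 beta is what makes it hold for large m. *)
Lemma Rpower_sqr_le (beta K eps m : R) :
  beta < 1 / 2 -> 0 < K -> 0 < eps -> 0 < m ->
  exp (ln (K / eps) / (1 - 2 * beta)) <= m -> K * Rpower (m * m) beta <= eps * m.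
Proof.
intros Hbeta HK Heps Hm Hle.
assert (Hlog : ln (K / eps) <= (1 - 2 * beta) * ln m).
{ apply ln_le in Hle; [|apply exp_pos]; rewrite ln_exp in Hle.
  apply Rmult_le_compat_l with (r := 1 - 2 * beta) in Hle; [|lra].
  replace ((1 - 2 * beta) * (ln (K / eps) / (1 - 2 * beta))) with (ln (K / eps)) in Hle by (field; lra).
  exact Hle. }
assert (HKe : 0 < K / eps) by (apply Rdiv_lt_0_compat; assumption).
replace K with (eps * exp (ln (K / eps))) by (rewrite exp_ln by exact HKe; field; lra).
unfold Rpower; rewrite ln_mult by assumption.
rewrite Rmult_assoc, <- exp_plus.
apply Rmult_le_compat_l; [lra|].
rewrite <- (exp_ln m Hm) at 3.
destruct (Rle_lt_or_eq_dec (ln (K / eps) + beta * (ln m + ln m)) (ln m)) as [H | H]; [lra | |].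
- left; apply exp_increasing, H.
- right; f_equal; exact H.
Qed.

(** The growth condition concerns the open region; it extends to the parabola
    itself by continuity, moving w horizontally by a small amount d into the
    strip. *)
Lemma growth_little_o_strip (rho beta K : R) (f : C -> C) :
  0 < rho -> holo_strip rho f -> beta < 1 / 2 -> 0 < K ->
  (exists M : R, 0 < M /\
     forall z : C, parabola_interior rho z -> M <= Cmod z ->
       Cmod (f z) <= K * Rpower (Cmod z) beta) ->
  little_o_strip rho f.
Proof.
intros Hrho Hf Hbeta HK [M [HM Hgr]] eps Heps.
set (M1 := M + 1 + exp (ln (K / eps) / (1 - 2 * beta))).
pose proof (exp_pos (ln (K / eps) / (1 - 2 * beta))) as Hexp.
assert (Hint : forall w, 0 <= Re w < rho -> M1 <= Cmod w -> Cmod (f (- (w * w))%C) <= eps * Cmod w).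
{ intros w Hw Hm; unfold M1 in Hm.
  assert (Hz : Cmod (- (w * w)) = Cmod w * Cmod w) by (rewrite Cmod_opp, Cmod_mult; reflexivity).
  eapply Rle_trans; [apply Hgr|].
  - unfold parabola_interior; rewrite Re_sqrt_neg_opp_sqr; lra.
  - rewrite Hz; nra.
  - rewrite Hz; apply Rpower_sqr_le; lra. }
exists (M1 + 1); split; [unfold M1; lra|].
intros w [Hw0 Hw] Hm.
destruct Hw as [Hw | Hw]; [apply Hint; lra|].
apply le_epsilon; intros e He.
assert (Hc : Ccont (fun w => f (- (w * w))%C) w).
{ apply Cdiff_Ccont, (Cdiff_comp f); [apply Hf; lra|].
  apply Cdiff_opp, Cdiff_mult; apply Cdiff_id. }
set (eta := e / (1 + eps)).
assert (Heta : 0 < eta) by (apply Rdiv_lt_0_compat; lra).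
destruct (proj1 (Ccont_eps _ _) Hc eta Heta) as [delta [Hd Hloc]].
(* d <= 1 keeps |w - d| above the threshold M1, d < delta controls f, and
   d <= eta controls eps |w - d|; then eta + eps eta = e. *)
set (d := Rmin (Rmin (delta / 2) rho) (Rmin 1 eta)).
assert (Hd0 : 0 < d) by (repeat apply Rmin_pos; lra).
assert (Hd1 : d <= delta / 2) by (unfold d; eapply Rle_trans; [apply Rmin_l | apply Rmin_l]).
assert (Hd2 : d <= rho) by (unfold d; eapply Rle_trans; [apply Rmin_l | apply Rmin_r]).
assert (Hd3 : d <= 1) by (unfold d; eapply Rle_trans; [apply Rmin_r | apply Rmin_l]).
assert (Hd4 : d <= eta) by (unfold d; eapply Rle_trans; [apply Rmin_r | apply Rmin_r]).
set (w' := (w - RtoC d)%C).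
assert (HRe : Re w' = rho - d) by (rewrite <- Hw; reflexivity).
assert (Hdist : Cmod (w' - w) = d).
{ replace (w' - w)%C with (- RtoC d)%C by (unfold w'; ring).
  rewrite Cmod_opp, Cmod_R, Rabs_pos_eq; lra. }
pose proof (Cmod_triangle (w - w') w') as Ht1.
replace (w - w' + w')%C with w in Ht1 by ring.
replace (w - w')%C with (- (w' - w))%C in Ht1 by ring; rewrite Cmod_opp, Hdist in Ht1.
pose proof (Cmod_triangle (w' - w) w) as Ht2.
replace (w' - w + w)%C with w' in Ht2 by ring; rewrite Hdist in Ht2.
specialize (Hloc w' ltac:(lra)); cbv beta in Hloc.
specialize (Hint w' ltac:(lra) ltac:(lra)).
pose proof (Cmod_triangle (- (f (- (w' * w'))%C - f (- (w * w))%C)) (f (- (w' * w'))%C)) as Ht3.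
rewrite Cmod_opp in Ht3.
replace (- (f (- (w' * w')) - f (- (w * w))) + f (- (w' * w')))%C with (f (- (w * w))%C) in Ht3 by ring.
assert (eps * Cmod w' <= eps * (Cmod w + eta)) by (apply Rmult_le_compat_l; lra).
assert (He' : eta + eps * eta = e) by (unfold eta; field; lra).
lra.
Qed.

(** One factor is of order |w|^2 and the others are at least 1, which is all
    that the decay 1 / t^2 requires. *)
Lemma node_prod_lower (n : nat) (x : nat -> R) :
  (forall j, (j <= n)%nat -> 0 <= x j) ->
  exists M, 0 < M /\ forall w, M <= Cmod w ->
    Cmod w * Cmod w / 2 <= Cmod (node_prod n x (- (w * w))%C).
Proof.
unfold node_prod; induction n as [|n IH]; intros Hx.
- exists (2 * x O + 1); specialize (Hx O (le_n _)); split; [lra|].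
  intros w Hw; simpl; apply Cmod_sqr_minus_ge; [exact Hx | nra].
- destruct IH as [M [HM H]]; [intros; apply Hx; lia|].
  exists (M + 2 * x (S n) + 2); specialize (Hx (S n) (le_n _)); split; [lra|].
  intros w Hw; simpl; rewrite Cmod_mult.
  specialize (H w ltac:(lra)).
  pose proof (Cmod_sqr_minus_ge w (x (S n)) Hx ltac:(nra)) as H2.
  assert (1 <= Cmod (- (w * w) - RtoC (x (S n)))) by nra.
  assert (0 <= Cmod w * Cmod w / 2) by nra.
  nra.
Qed.

Lemma Cdiff_node_prod (n : nat) (x : nat -> R) (z : C) : Cdiff (node_prod n x) z.
Proof.
unfold node_prod; induction n as [|n IH]; simpl.
- apply Cdiff_minus; [apply Cdiff_id | apply Cdiff_const].
- apply Cdiff_mult; [exact IH|].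
  apply Cdiff_minus; [apply Cdiff_id | apply Cdiff_const].
Qed.

(** For large |w| the growth condition gives |f| <= |w|, the factor from the path is 2 |w|, and the
    denominator is at least (|w|^2 / 2)^2; hence the bound 8 / |w|^2. *)
Lemma Hermite_integrand_decay (rho : R) (f : C -> C) (n : nat) (x : nat -> R) (y : R) :
  0 < rho -> little_o_strip rho f -> (forall j, (j <= n)%nat -> 0 <= x j) -> 0 <= y ->
  exists T1, forall t, T1 <= Rabs t ->
    Cmod (f (parabola_path rho t) /
      (node_prod n x (parabola_path rho t) * (parabola_path rho t - RtoC y))
      * - (2 * (rho, t) * Ci)) <= 8 / (t * t).
Proof.
intros Hrho Ho Hx Hy.
destruct (Ho 1 Rlt_0_1) as [M1 [HM1 Hf]].
destruct (node_prod_lower n x Hx) as [M2 [HM2 Hn]].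
exists (M1 + M2 + 2 * y + 1); intros t Ht.
unfold parabola_path; set (w := (rho, t) : C).
pose proof (im_le_Cmod w) as Him; change (Im w) with t in Him.
set (m := Cmod w) in *.
specialize (Hf w ltac:(simpl; lra)); specialize (Hn w); fold m in Hf, Hn.
specialize (Hf ltac:(lra)); specialize (Hn ltac:(lra)).
assert (Hym : 2 * y <= m * m) by nra.
pose proof (Cmod_sqr_minus_ge w y Hy Hym) as Hd; fold m in Hd.
assert (Hmm : 1 <= m * m) by nra.
unfold Cdiv; rewrite !Cmod_mult, Cmod_opp, !Cmod_mult, Cmod_Ci, Cmod_R, (Rabs_pos_eq 2) by lra; fold m.
assert (Hne : (node_prod n x (- (w * w)) * (- (w * w) - RtoC y))%C <> RtoC 0).
{ apply Cmult_neq_0; apply Cmod_gt_0; lra. }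
rewrite Cmod_inv by exact Hne; rewrite Cmod_mult.
set (P := Cmod (node_prod n x (- (w * w)))%C) in *.
set (D := Cmod (- (w * w) - RtoC y)) in *.
set (F := Cmod (f (- (w * w))%C)) in *.
assert (HF : 0 <= F) by apply Cmod_ge_0.
assert (HPD : m * m / 2 * (m * m / 2) <= P * D) by (apply Rmult_le_compat; lra).
assert (Htt : t * t <= m * m).
{ replace (t * t) with (Rabs t * Rabs t).
  - pose proof (Rabs_pos t); apply Rmult_le_compat; lra.
  - rewrite <- Rabs_mult, Rabs_pos_eq; [reflexivity | nra]. }
assert (Ht0 : 0 < t * t).
{ assert (t <> 0) by (intros ->; rewrite Rabs_R0 in Ht; lra).
  pose proof (Rsqr_pos_lt t H); assumption. }
assert (0 < P * D) by nra.
apply Rmult_le_reg_r with (P * D * (t * t)); [apply Rmult_lt_0_compat; assumption|].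
replace (F * / (P * D) * (2 * m * 1) * (P * D * (t * t))) with (2 * (F * m) * (t * t)) by (field; nra).
replace (8 / (t * t) * (P * D * (t * t))) with (8 * (P * D)) by (field; nra).
assert (F * m <= m * m) by (apply Rmult_le_compat_r; lra).
assert (F * m * (t * t) <= m * m * (m * m)) by (apply Rmult_le_compat; nra).
lra.
Qed.

(** * The remainder formula *)

Lemma increasing_nodes (n : nat) (x : nat -> R) :
  (forall j : nat, (j < n)%nat -> x j < x (S j)) ->
  forall i j, (i < j)%nat -> (j <= n)%nat -> x i < x j.
Proof.
intros Hx i j Hij; induction Hij as [|j Hij IH]; intros Hj.
- apply Hx; lia.
- apply Rlt_trans with (x j); [apply IH; lia | apply Hx; lia].
Qed.

Lemma node_or_not (n : nat) (x : nat -> R) (y : R) :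
  (exists j, (j <= n)%nat /\ y = x j) \/ (forall j, (j <= n)%nat -> y <> x j).
Proof.
induction n as [|n IH].
- destruct (Req_dec y (x O)) as [E | E]; [left; exists O; auto|].
  right; intros j Hj; replace j with O by lia; exact E.
- destruct (Req_dec y (x (S n))) as [E | E]; [left; exists (S n); auto|].
  destruct IH as [[j [Hj Ej]] | IH]; [left; exists j; split; [lia | exact Ej]|].
  right; intros j Hj; destruct (Nat.eq_dec j (S n)) as [-> | Hne]; [exact E | apply IH; lia].
Qed.

Theorem lemma4p1 (rho : R) (f : C -> C) (beta K : R) (n : nat) (x : nat -> R) :
  0 < rho ->
  analytic_near f (fun z => parabola_interior rho z \/ parabola rho z) ->
  beta < 1 / 2 ->
  0 < K ->
  (exists M : R, 0 < M /\
     forall z : C, parabola_interior rho z -> M <= Cmod z ->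
       Cmod (f z) <= K * Rpower (Cmod z) beta) ->
  0 <= x 0%nat ->
  (forall j : nat, (j < n)%nat -> x j < x (S j)) ->
  exists p : C -> C,
    interpolant n x f p /\
    (forall q : C -> C, interpolant n x f q -> forall z : C, q z = p z) /\
    forall c : C, c <> RtoC 0 ->
    forall y : R, 0 <= y ->
    exists l : C,
      is_contour_int (parabola_path rho)
        (fun z => node_poly c n x (RtoC y) * f z
                  / (node_poly c n x z * (z - RtoC y)))%C l /\
      (f (RtoC y) - p (RtoC y) = / (2 * PI * Ci) * l)%C.
Proof.
intros Hrho Hanal Hbeta HK Hgr Hx0 Hx.
pose proof (analytic_near_holo_strip rho f Hanal) as Hf.
pose proof (growth_little_o_strip rho beta K f Hrho Hf Hbeta HK Hgr) as Ho.
pose proof (increasing_nodes n x Hx) as Hincr.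
assert (Hdist : distinct_nodes n x).
{ intros i j Hi Hj; apply Rlt_not_eq, Hincr; assumption. }
assert (Hpos : forall j, (j <= n)%nat -> 0 <= x j).
{ intros [|j] Hj; [exact Hx0|].
  pose proof (Hincr O (S j) ltac:(lia) Hj); lra. }
pose proof (newton_interpolant n x f Hdist) as Hp.
exists (newton f x n); split; [exact Hp | split].
{ intros q Hq; exact (interpolant_unique n x f _ q Hdist Hp Hq). }
intros c Hc y Hy.
assert (Hpath : forall t, node_prod n x (parabola_path rho t) <> RtoC 0).
{ intros t; apply node_prod_neq_0; intros j Hj; apply parabola_path_neq; auto. }
assert (Hpathy : forall t, (parabola_path rho t - RtoC y)%C <> RtoC 0).
{ intros t; apply Cminus_neq_0, parabola_path_neq; assumption. }
set (A := node_prod n x (RtoC y)).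
set (g := fun z => (A * (f z / (node_prod n x z * (z - RtoC y))))%C).
assert (H2pi : (2 * PI * Ci)%C <> RtoC 0).
{ intros E; apply (f_equal snd) in E; simpl in E; pose proof PI_RGT_0; lra. }
assert (Hpv : exists l, pv rho g l /\
  (f (RtoC y) - newton f x n (RtoC y) = / (2 * PI * Ci) * l)%C).
{ destruct (node_or_not n x y) as [[j [Hj Ey]] | Hyx].
  - (* At a node both the integrand and the interpolation error vanish: the
       integral is a convergent one multiplied by A = 0. *)
    assert (EA : A = RtoC 0) by (unfold A; rewrite Ey; apply node_prod_root, Hj).
    exists (A * (2 * PI * Ci * f (RtoC y)))%C; split.
    + apply (pv_ext rho (fun z => A * (f z / (z - RtoC y)))%C).
      * intros t; unfold g; rewrite EA; ring.
      * apply pv_scal, pv_Cauchy; assumption.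
    + rewrite EA, Ey, (proj2 Hp) by exact Hj; ring.
  - assert (EA : A <> RtoC 0).
    { apply node_prod_neq_0; intros j Hj E; apply RtoC_inj in E; apply (Hyx j Hj E). }
    exists (A * (2 * PI * Ci * ((f (RtoC y) - newton f x n (RtoC y)) / A)))%C; split.
    + apply pv_scal, pv_Hermite; assumption.
    + set (k := (2 * PI * Ci)%C) in *; field; split; assumption. }
destruct Hpv as [l [Hl El]]; exists l; split; [|exact El].
destruct (Hermite_integrand_decay rho f n x y Hrho Ho Hpos Hy) as [T1 HT1].
pose proof (Cmod_ge_0 A) as HA.
assert (Eg : forall t, (node_poly c n x (RtoC y) * f (parabola_path rho t)
    / (node_poly c n x (parabola_path rho t) * (parabola_path rho t - RtoC y)))%C
  = g (parabola_path rho t)).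
{ intros t; unfold g, A.
  change (node_poly c n x) with (fun z => c * node_prod n x z)%C; cbv beta.
  field; repeat split; auto. }
apply (contour_int_of_pv rho _ (Cmod A * 8) T1).
- intros t.
  change (node_poly c n x) with (fun z => c * node_prod n x z)%C; cbv beta.
  apply Cdiff_div.
  + apply Cdiff_mult; [apply Cdiff_const|].
    apply Hf; simpl; lra.
  + apply Cdiff_mult.
    * apply Cdiff_mult; [apply Cdiff_const | apply Cdiff_node_prod].
    * apply Cdiff_minus; [apply Cdiff_id | apply Cdiff_const].
  + repeat apply Cmult_neq_0; auto.
- lra.
- intros t Ht; rewrite Eg; unfold g.
  rewrite <- Cmult_assoc, Cmod_mult.
  unfold Rdiv; rewrite Rmult_assoc; apply Rmult_le_compat_l; [exact HA | apply HT1, Ht].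
- apply (pv_ext rho g); [intros t; symmetry; apply Eg | exact Hl].
Qed.
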